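(* Let $P_3$ be the triangle graph. For a polynomial $p(x)\in\mathbb Z[x]$ put $\mathcal A_{p(x)}=\mathbb Z[x]/(p(x))$ and let $p'(x)$ be the derivative of $p(x)$. Equalities of groups below mean isomorphism of abelian groups. (i) $H^1_{\mathcal A_{p(x)}}(P_3)=\mathbb Z[x]/(p(x),p'(x))$, where $(p(x),p'(x))$ is the ideal generated by $p(x)$ and $p'(x)$. In particular, $\operatorname{rank}H^1_{\mathcal A_{p(x)}}(P_3)=\deg_{\mathbb Q}(\gcd(p(x),p'(x)))$. Equivalently, $\operatorname{rank}H^1_{\mathcal A_{p(x)}}(P_3)=\sum_{x_i}(\mathrm{mul}(x_i)-1)$, where the sum is taken over all roots $x_i$ of $p(x)$ and $\mathrm{mul}(x_i)$ is the multiplicity of the root $x_i$. (ii) $H^0_{\mathcal A_{p(x)}}(P_3)=\mathbb Z^{\,m(m-1)(m-2)+\deg_{\mathbb Q}(\gcd(p(x),p'(x)))}$, where $m=\deg(p(x))$ is the degree of $p(x)$. (iii) More generally, consider the algebra $\mathcal A=\mathbb Z[x]/\mathbb I$, where $\mathbb I$ is an ideal in $\mathbb Z[x]$. Let $\mathbb I'$ be the ideal generated by the derivatives of elements of $\mathbb I$ (note that $\mathbb I\subset\mathbb I'$, because for any $p(x)\in\mathbb I$ we have $p(x)=(xp(x))'-xp'(x)$). Then $H^1_{\mathbb Z[x]/\mathbb I}(P_3)=\mathbb Z[x]/\mathbb I'$.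
   Context: Graph cohomology over a commutative ring $\mathcal A$ with identity (no grading and no freeness required here; no restrictions are placed on $p(x)$): let $G$ be a finite graph with ordered edges $e_1,\dots,e_n$. For $s\subseteq E(G)$ let $[G:s]$ be the graph with vertex set $V(G)$ and edge set $s$, and let $C^{s}(G)=\mathcal A^{\otimes k}$ (tensor over $\mathbb Z$, one factor per connected component of $[G:s]$, $k$ being the number of components). Put $C^i(G)=\bigoplus_{|s|=i}C^s(G)$. For $e\notin s$ the per-edge map $C^{s}(G)\to C^{s\cup\{e\}}(G)$ is the identity if $e$ joins a component of $[G:s]$ to itself; if $e$ joins two different components it multiplies the two corresponding tensor factors via $\mathcal A\otimes\mathcal A\to\mathcal A$ and is the identity on the other factors. The differential $d^i:C^i(G)\to C^{i+1}(G)$ is the sum of the per-edge maps over all $|s|=i$ and $e=e_r\notin s$, with sign $(-1)^{\#\{t<r:\ e_t\in s\}}$. $H^i_{\mathcal A}(G)$ is the $i$-th cohomology group of $(C^*(G),d)$. The triangle $P_3$ is the graph with 3 vertices and 3 edges forming a cycle. $\operatorname{rank}M=\dim_{\mathbb Q}(M\otimes_{\mathbb Z}\mathbb Q)$; $\deg_{\mathbb Q}(\gcd(p,p'))$ is the degree of the greatest common divisor computed in $\mathbb Q[x]$.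
   Formalization: Part (ii) fails for general p (e.g. p=2 or p=2x^3-1): its isomorphism is proved when the leading coefficient of p is ±1, and for every other p≠0 only the rank equality is proved. The rank formulas in (i) are stated for p≠0, since they are undefined at p=0. *)

(* Defs.v *)
From HB Require Import structures.
From mathcomp Require Import all_boot all_order all_algebra all_field.
From mathcomp.multinomials Require Import freeg.
From mathcomp Require Import boolp classical_sets fsbigop.

Set Implicit Arguments.
Unset Strict Implicit.
Unset Printing Implicit Defensive.

Import GRing.Theory Num.Theory.
Local Open Scope ring_scope.
Local Open Scope quotient_scope.
Local Open Scope classical_set_scope.

Definition zmod_iso (U V : zmodType) : Prop :=
  exists f : {additive U -> V}, bijective f.

Section ZSpan.
Variables (U : zmodType) (S : set U).

Definition zspan : {pred U} :=
  fun x => `[< forall J : zmodClosed U, (forall y, S y -> y \in J) -> x \in J >].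

Lemma zspanP x : reflect
  (forall J : zmodClosed U, (forall y, S y -> y \in J) -> x \in J) (x \in zspan).
Proof. exact: asboolP. Qed.

Lemma mem_zspan x : S x -> x \in zspan.
Proof. by move=> Sx; apply/zspanP => J; apply. Qed.

Fact zspan_closed : zmod_closed zspan.
Proof.
split=> [|x y /zspanP xS /zspanP yS]; apply/zspanP => J SJ; first exact: rpred0.
by rewrite rpredB ?xS ?yS.
Qed.
HB.instance Definition _ := GRing.isZmodClosed.Build U zspan zspan_closed.

End ZSpan.

Definition fgen (T : choiceType) (x : T) : {freeg T} := << x >>.

Definition present (T : choiceType) (S : set {freeg T}) :=
  {ideal_quot (zspan S)}.
HB.instance Definition _ (T : choiceType) (S : set {freeg T}) :=
  GRing.Zmodule.on (present S).

Section Present.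
Variables (T : choiceType) (S : set {freeg T}).

Definition pgen (x : T) : present S := \pi_{ideal_quot (zspan S)} (fgen x).

Lemma pi_rel r : S r -> \pi_{ideal_quot (zspan S)} r = 0.
Proof.
move=> Sr; rewrite -(raddf0 \pi_{ideal_quot (zspan S)}); apply/eqP.
by rewrite -Quotient.idealrBE subr0; exact: mem_zspan.
Qed.

Variables (M : zmodType) (f : T -> M).

Definition fglin : {freeg T} -> M := fglift (f : T -> zmodule M).

Fact fglin_is_zmod_morphism : zmod_morphism fglin.
Proof. exact: (@lift_is_additive int T (zmodule M) f). Qed.
HB.instance Definition _ :=
  GRing.isZmodMorphism.Build {freeg T} M fglin fglin_is_zmod_morphism.

Lemma fglinE x : fglin (fgen x) = f x.
Proof. by rewrite /fglin liftU scale1r. Qed.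

Definition plift : present S -> M := fun x => fglin (repr x).

Hypothesis fS : forall r, S r -> fglin r = 0.

Let kerf : pred {freeg T} := fun r => fglin r == 0.
Let kerf_closed : zmod_closed kerf.
Proof.
have kE z : (z \in kerf) = (fglin z == 0) by [].
split=> [|x y]; rewrite !kE ?raddf0 //.
by move=> /eqP fx /eqP fy; rewrite raddfB /= fx fy subrr.
Qed.

Lemma plift_pi r : plift (\pi_{ideal_quot (zspan S)} r) = fglin r.
Proof.
apply/eqP; rewrite -subr_eq0 -raddfB /=.
pose J : zmodClosed {freeg T} := HB.pack kerf
  (GRing.isZmodClosed.Build _ kerf kerf_closed).
have: repr (\pi_{ideal_quot (zspan S)} r) - r \in zspan S.
  by rewrite Quotient.idealrBE reprK.
by move=> /zspanP/(_ J); apply=> y /fS fy; apply/eqP.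
Qed.

Lemma plift_gen x : plift (pgen x) = f x.
Proof. by rewrite plift_pi fglinE. Qed.

Lemma plift_is_zmod_morphism : zmod_morphism plift.
Proof.
move=> x y; rewrite -[x]reprK -[y]reprK -raddfB.
by rewrite !plift_pi raddfB.
Qed.

End Present.

Lemma present_ext (T : choiceType) (S : set {freeg T}) (M : zmodType)
    (f g : present S -> M) :
    zmod_morphism f -> zmod_morphism g ->
  (forall x, f (pgen S x) = g (pgen S x)) -> f =1 g.
Proof.
move=> fB gB fg x.
pose f' : {additive _ -> _} := HB.pack f
  (GRing.isZmodMorphism.Build _ _ f fB).
pose g' : {additive _ -> _} := HB.pack g
  (GRing.isZmodMorphism.Build _ _ g gB).
rewrite -[f]/(f' : _ -> _) -[g]/(g' : _ -> _) -[x]reprK.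
rewrite -(freeg_sumE (repr x)) !raddf_sum; apply: eq_bigr => y _.
have -> : << coeff y (repr x) *g y >> = fgen y *~ coeff y (repr x).
  by rewrite /fgen freeg_mulz intz.
by rewrite !raddfMz; congr (_ *~ _); exact: fg.
Qed.

Section TensorPower.
Variables (A : zmodType) (K : finType).

Definition fset_at (f : {ffun K -> A}) (k : K) (a : A) : {ffun K -> A} :=
  [ffun j => if j == k then a else f j].

(* The tensor power of A over Z with one factor for each element of K: the   *)
(* free abelian group on {ffun K -> A} modulo additivity in each variable.    *)
Definition tensor_rel : set {freeg {ffun K -> A}} := fun r =>
  exists f k a b,
    r = fgen (fset_at f k (a + b))
        - (fgen (fset_at f k a) + fgen (fset_at f k b)).

Definition tensor_power := present tensor_rel.
HB.instance Definition _ := GRing.Zmodule.on tensor_power.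

Definition pure (f : {ffun K -> A}) : tensor_power := pgen tensor_rel f.

End TensorPower.

Section Merge.
Variables (A : comPzRingType) (K L : finType) (h : K -> L).

Definition merge_factors (f : {ffun K -> A}) : {ffun L -> A} :=
  [ffun l => \prod_(k | h k == l) f k].

(* The map A^{(x) K} -> A^{(x) L} multiplying the factors in each fibre of h. *)
Definition merge : tensor_power A K -> tensor_power A L :=
  plift (fun f => pure (merge_factors f)).

Fact merge_rel r :
  @tensor_rel A K r -> fglin (fun f => pure (merge_factors f)) r = 0.
Proof.
move=> [f] [k] [a] [b] ->; rewrite raddfB raddfD /= !fglinE /pure.
have E c : merge_factors (fset_at f k c) =
    fset_at (merge_factors f) (h k) (c * \prod_(j | (h j == h k) && (j != k)) f j).
  apply/ffunP => l; rewrite !ffunE; case: (eqVneq l (h k)) => [->|ne].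
    rewrite (bigD1 k) //= ffunE eqxx; congr (_ * _).
    by apply: eq_bigr => j /andP[_ /negPf jk]; rewrite ffunE jk.
  apply: eq_bigr => j /eqP hj; rewrite ffunE; case: eqP => // jk.
  by rewrite -hj jk eqxx in ne.
rewrite !E mulrDl; set u := a * _; set v := b * _.
rewrite -!raddfD -!raddfB; apply: pi_rel.
by exists (merge_factors f), (h k), u, v.
Qed.

HB.instance Definition _ := GRing.isZmodMorphism.Build
  (tensor_power A K) (tensor_power A L) merge
  (plift_is_zmod_morphism merge_rel).

Lemma merge_pure f : merge (pure f) = pure (merge_factors f).
Proof. exact: (plift_gen merge_rel). Qed.

End Merge.

Lemma merge_comp (A : comPzRingType) (K L N : finType) (h : K -> L) (g : L -> N)
    (x : tensor_power A K) :
  merge g (merge h x) = merge (g \o h) x.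
Proof.
move: x; apply: present_ext => [x y|x y|f]; rewrite ?raddfB //.
rewrite -/(pure f) !merge_pure; congr pure; apply/ffunP => n; rewrite !ffunE.
rewrite (partition_big h (fun l => g l == n)) //=.
apply: eq_bigr => l /eqP gl; rewrite ffunE; apply: eq_bigl => k.
by case: (eqVneq (h k) l) => [->|]; rewrite ?andbF // gl eqxx.
Qed.

Section Rank.
Variable M : zmodType.

(* M (x)_Z Q, on which Q acts through the second factor. *)
Definition tensQ_rel : set {freeg (M * rat)%type} := fun r =>
  (exists x y q, r = fgen (x + y, q) - (fgen (x, q) + fgen (y, q))) \/
  (exists x q s, r = fgen (x, q + s) - (fgen (x, q) + fgen (x, s))).

Definition tensQ := present tensQ_rel.
HB.instance Definition _ := GRing.Zmodule.on tensQ.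

Definition tens (x : M) (q : rat) : tensQ := pgen tensQ_rel (x, q).

Lemma tensDl x y q : tens (x + y) q = tens x q + tens y q.
Proof.
apply/eqP; rewrite -subr_eq0 -!raddfD -raddfB; apply/eqP/pi_rel.
by left; exists x, y, q.
Qed.

Lemma tensDr x q s : tens x (q + s) = tens x q + tens x s.
Proof.
apply/eqP; rewrite -subr_eq0 -!raddfD -raddfB; apply/eqP/pi_rel.
by right; exists x, q, s.
Qed.

Definition tensQ_scale (c : rat) : tensQ -> tensQ :=
  plift (fun xq => tens xq.1 (c * xq.2)).

Fact tensQ_scale_rel c r :
  tensQ_rel r -> fglin (fun xq => tens xq.1 (c * xq.2)) r = 0.
Proof.
by case=> -[x] [y] [q] ->; rewrite raddfB raddfD /= !fglinE /=
  ?mulrDr ?tensDl ?tensDr subrr.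
Qed.

Let scaleB c : zmod_morphism (tensQ_scale c).
Proof. exact: plift_is_zmod_morphism (@tensQ_scale_rel c). Qed.

Lemma tensQ_scale_tens c x q : tensQ_scale c (tens x q) = tens x (c * q).
Proof. exact: (plift_gen (@tensQ_scale_rel c)). Qed.

Fact tensQ_scaleA b c u :
  tensQ_scale b (tensQ_scale c u) = tensQ_scale (b * c) u.
Proof.
move: u; apply: present_ext => [x y||[x q]]; last first.
- by rewrite -/(tens x q) !tensQ_scale_tens mulrA.
- exact: scaleB.
- by rewrite !scaleB.
Qed.

Fact tensQ_scale1 : left_id 1 tensQ_scale.
Proof.
apply: present_ext => [||[x q]]; [exact: scaleB | by [] |].
by rewrite -/(tens x q) tensQ_scale_tens mul1r.
Qed.

Fact tensQ_scaleDr : right_distributive tensQ_scale +%R.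
Proof.
move=> c u v; pose g : {additive tensQ -> tensQ} := HB.pack (tensQ_scale c)
  (GRing.isZmodMorphism.Build _ _ (tensQ_scale c) (scaleB c)).
exact: (raddfD g).
Qed.

Fact tensQ_scaleDl u : {morph tensQ_scale^~ u : b c / b + c}.
Proof.
move=> b c; move: u; apply: present_ext => [|x y|[x q]]; first exact: scaleB.
  by rewrite !scaleB opprD addrACA.
by rewrite -/(tens x q) !tensQ_scale_tens mulrDl tensDr.
Qed.

HB.instance Definition _ := GRing.Zmodule_isLmodule.Build rat tensQ
  tensQ_scaleA tensQ_scale1 tensQ_scaleDr tensQ_scaleDl.

(* dim_Q (M (x) Q) = r *)
Definition has_rank (r : nat) : Prop :=
  exists f : {linear tensQ -> 'rV[rat]_r}, bijective f.

End Rank.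

(* Unlike those of ring_quotient, ideals may be improper here. *)

HB.mixin Record isMulAbsorbing (R : pzRingType) (S : R -> bool) := {
  mul_absorbing : forall a : R, {in S, forall u, a * u \in S}
}.

#[short(type="ideal")]
HB.structure Definition Ideal (R : pzRingType) :=
  {S of GRing.ZmodClosed R S & isMulAbsorbing R S}.

Section IdealQuotient.
Variables (R : comPzRingType) (I : ideal R).

Definition ring_quot := {ideal_quot I}.
HB.instance Definition _ := GRing.Zmodule.on ring_quot.

Let cls (x : R) : ring_quot := \pi_{ideal_quot I} x.
Definition rq_one : ring_quot := cls 1.
Definition rq_mul (x y : ring_quot) : ring_quot := cls (repr x * repr y).

Fact rq_mul_pi x y : rq_mul (cls x) (cls y) = cls (x * y).
Proof.
apply/eqP; rewrite /rq_mul /cls -Quotient.idealrBE.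
set x' := repr _; set y' := repr _.
have -> : x' * y' - x * y = x' * (y' - y) + y * (x' - x).
  by rewrite !mulrBr (mulrC y x') (mulrC y x) addrA subrK.
by rewrite rpredD // mul_absorbing // Quotient.idealrBE reprK.
Qed.

Let clsE x : exists y, x = cls y. Proof. by exists (repr x); rewrite /cls reprK. Qed.

Fact rq_mulA : associative rq_mul.
Proof.
move=> x y z; have [a ->] := clsE x; have [b ->] := clsE y.
by have [c ->] := clsE z; rewrite !rq_mul_pi mulrA.
Qed.

Fact rq_mulC : commutative rq_mul.
Proof. by move=> x y; rewrite /rq_mul mulrC. Qed.

Fact rq_mul1 : left_id rq_one rq_mul.
Proof. by move=> x; have [a ->] := clsE x; rewrite rq_mul_pi mul1r. Qed.

Fact rq_mulDl : left_distributive rq_mul +%R.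
Proof.
move=> x y z; have [a ->] := clsE x; have [b ->] := clsE y.
have [c ->] := clsE z; rewrite -raddfD !rq_mul_pi -raddfD.
by rewrite -/(cls _) mulrDl.
Qed.

HB.instance Definition _ := GRing.Zmodule_isComPzRing.Build ring_quot
  rq_mulA rq_mulC rq_mul1 rq_mulDl.

End IdealQuotient.

Section IdealGen.
Variables (R : pzRingType) (S : set R).

Definition ideal_gen : {pred R} :=
  fun x => `[< forall J : ideal R, (forall y, S y -> y \in J) -> x \in J >].

Lemma ideal_genP x : reflect
  (forall J : ideal R, (forall y, S y -> y \in J) -> x \in J) (x \in ideal_gen).
Proof. exact: asboolP. Qed.

Fact ideal_gen_closed : zmod_closed ideal_gen.
Proof.
split=> [|x y /ideal_genP xS /ideal_genP yS]; apply/ideal_genP => J SJ.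
  exact: rpred0.
by rewrite rpredB ?xS ?yS.
Qed.
HB.instance Definition _ := GRing.isZmodClosed.Build R ideal_gen ideal_gen_closed.

Fact ideal_gen_absorbing a : {in ideal_gen, forall u, a * u \in ideal_gen}.
Proof.
move=> u /ideal_genP uS; apply/ideal_genP => J SJ.
by rewrite mul_absorbing ?uS.
Qed.
HB.instance Definition _ := isMulAbsorbing.Build R ideal_gen ideal_gen_absorbing.

End IdealGen.

Section DffunZmodule.
Variables (I : finType) (T : I -> zmodType).
Local Notation F := {dffun forall i : I, T i}.
Implicit Types f g : F.

Definition dffun_zero : F := [ffun i => 0 : T i].
Definition dffun_opp f : F := [ffun i => - f i : T i].
Definition dffun_add f g : F := [ffun i => f i + g i : T i].

Fact dffun_addA : associative dffun_add.
Proof. by move=> f g h; apply/ffunP => i; rewrite !ffunE addrA. Qed.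
Fact dffun_addC : commutative dffun_add.
Proof. by move=> f g; apply/ffunP => i; rewrite !ffunE addrC. Qed.
Fact dffun_add0 : left_id dffun_zero dffun_add.
Proof. by move=> f; apply/ffunP => i; rewrite !ffunE add0r. Qed.
Fact dffun_addN : left_inverse dffun_zero dffun_opp dffun_add.
Proof. by move=> f; apply/ffunP => i; rewrite !ffunE addNr. Qed.
HB.instance Definition _ := GRing.isZmodule.Build F
  dffun_addA dffun_addC dffun_add0 dffun_addN.

Lemma dffun0E i : (0 : F) i = 0. Proof. by rewrite ffunE. Qed.
Lemma dffunBE f g i : (f - g) i = f i - g i. Proof. by rewrite !ffunE. Qed.

End DffunZmodule.

Record graph := Graph {
  vertex : finType;
  nb_edges : nat;
  ends : 'I_nb_edges -> vertex * vertex
}.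

Section GraphCohomology.
Variables (A : comPzRingType) (G : graph).
Notation E := 'I_(nb_edges G).
Implicit Types s t : {set E}.

Definition adj s : rel (vertex G) := fun x y =>
  [exists e in s, (ends e == (x, y)) || (ends e == (y, x))].

Fact connect_adj_sym s : connect_sym (adj s).
Proof.
apply: sym_connect_sym => x y.
by apply: eq_existsb => e; rewrite orbC.
Qed.

(* A component of [G : s] is encoded by its canonical representative. *)
Definition component s : finType := {x : vertex G | x \in fingraph.roots (adj s)}.

Definition component_of s (x : vertex G) : component s :=
  Sub (fingraph.root (adj s) x) (roots_root (connect_adj_sym s) x).

Definition tensor_state s := tensor_power A (component s).

(* For s <= t, multiplies together the factors of the components of [G : s]   *)
(* lying in the same component of [G : t]. For t = e |: s this is the map of  *)
(* the edge e: if e joins a component to itself then s and t have the same    *)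
(* components, otherwise exactly two components are merged.                   *)
Definition state_map s t : tensor_state s -> tensor_state t :=
  merge (fun x : component s => component_of t (val x)).

(* The direct sum of all the C^s; C^i is the subgroup in_degree i.            *)
Definition cochain := {dffun forall s : {set E}, tensor_state s}.
HB.instance Definition _ := GRing.Zmodule.on cochain.
Implicit Types b c : cochain.

(* The component of d c at t sums the contributions of the pairs (s, e_r)     *)
(* with s = t :\ r and r in t.                                                *)
Definition differential c : cochain :=
  [ffun t => \sum_(r in t) @state_map (t :\ r) t (c (t :\ r))
               *~ (-1) ^+ #|[set q in t :\ r | (q < r)%N]| : tensor_state t].

Fact differential_is_zmod_morphism : zmod_morphism differential.
Proof.
move=> b c; apply/ffunP => t; rewrite dffunBE !ffunE -sumrB.
by apply: eq_bigr => r _; rewrite dffunBE /state_map raddfB mulrzBl.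
Qed.
HB.instance Definition _ := GRing.isZmodMorphism.Build
  cochain cochain differential differential_is_zmod_morphism.

Fact component_of_val s t x :
  s \subset t -> component_of t (val (component_of s x)) = component_of t x.
Proof.
move=> st; apply/val_inj/eqP; rewrite /= root_connect; last exact: connect_adj_sym.
have sub : subrel (connect (adj s)) (connect (adj t)).
  apply: connect_sub => y z /exists_inP[e es yz]; apply/connect1/exists_inP.
  by exists e => //; exact: (fintype.subsetP st).
by rewrite (connect_adj_sym t) sub // connect_root.
Qed.

Fact state_map_comp (s u t : {set E}) (x : tensor_state s) : s \subset u -> u \subset t ->
  @state_map u t (@state_map s u x) = @state_map s t x.
Proof.
move=> su ut; rewrite /state_map merge_comp; congr (merge _ x).
by apply: funext => y /=; exact: component_of_val.
Qed.

Lemma differential_comp c : differential (differential c) = 0.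
Proof.
apply/ffunP => t; rewrite dffun0E ffunE.
pose n (t : {set E}) (r : E) := #|[set q in t :\ r | (q < r)%N]|.
pose F r q := @state_map (t :\ r :\ q) t (c (t :\ r :\ q)).
pose sg r q : int := (-1) ^+ (n (t :\ r) q + n t r).
transitivity (\sum_(r in t) \sum_(q in t :\ r) F r q *~ sg r q).
  apply: eq_bigr => r rt; rewrite ffunE /state_map raddf_sum mulrz_suml.
  apply: eq_bigr => q qt; rewrite raddfMz -mulrzA /sg -exprD; congr (_ *~ _).
  by rewrite /F -(@state_map_comp _ (t :\ r) t) ?subsetDl.
have FC r q : F r q = F q r by rewrite /F finset.setDDl finset.setUC -finset.setDDl.
have sgC r q : r \in t -> q \in t -> (q < r)%N -> sg q r = - sg r q.
  move=> rt qt qr; rewrite /sg.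
  have -> : n (t :\ r) q = n t q.
    apply: eq_card => e; rewrite !inE; case: eqP => //= _.
    by case: (eqVneq e r) => [->|//]; rewrite /= ltnNge (ltnW qr) andbF.
  have -> : n t r = (n (t :\ q) r).+1.
    have nqr : (q == r) = false by rewrite -val_eqE; exact: ltn_eqF.
    rewrite /n (cardsD1 q) !inE qr qt nqr /=; congr _.+1.
    by apply: eq_card => e; rewrite !inE; do ![case: eqP => //= _].
  by rewrite addnS exprS mulN1r opprK addnC.
transitivity (\sum_(r in t) \sum_(q in t | (q < r)%N) F r q *~ sg r q
            + \sum_(r in t) \sum_(q in t | (r < q)%N) F r q *~ sg r q).
  rewrite -big_split; apply: eq_bigr => r rt /=.
  rewrite (bigID (fun q : E => (q < r)%N)) /=; congr (_ + _);
    apply: eq_bigl => q; rewrite !inE -(inj_eq val_inj) /=; case: ltngtP;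
    by rewrite ?andbF ?andbT.
rewrite [X in _ + X](exchange_big_dep (mem t)) /=; last by move=> i j _ /andP[].
rewrite -big_split big1 // => r rt /=.
rewrite [X in _ + X](eq_bigl (fun q => (q \in t) && (q < r)%N)); last first.
  by move=> q; rewrite rt.
rewrite -big_split big1 // => q /andP[qt qr] /=.
by rewrite [F q r]FC (sgC _ _ rt qt qr) mulrNz subrr.
Qed.

Definition in_degree (i : nat) : {pred cochain} :=
  fun c => [forall s : {set E}, (#|s| != i) ==> (c s == 0)].

Definition cocycle (i : nat) : {pred cochain} :=
  fun c => (c \in in_degree i) && (differential c == 0).

Fact in_degreeP i c :
  reflect (forall s, #|s| != i -> c s = 0) (c \in in_degree i).
Proof.
apply: (iffP forallP) => cS s; last by apply/implyP => /cS->.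
by move=> si; apply/eqP; apply: (implyP (cS s)).
Qed.

Lemma differential_degree i c :
  c \in in_degree i -> differential c \in in_degree i.+1.
Proof.
move=> /in_degreeP ci; apply/in_degreeP => t ti; rewrite ffunE big1 // => r rt.
rewrite ci /state_map ?raddf0 ?mul0rz //.
by apply: contraNneq ti => <-; rewrite (cardsD1 r t) rt.
Qed.

Fact cocycle_closed i : zmod_closed (cocycle i).
Proof.
split=> [|b c]; rewrite /cocycle !unfold_in.
  rewrite raddf0 eqxx andbT; apply/in_degreeP => s _; exact: dffun0E.
move=> /andP[/in_degreeP bi /eqP db] /andP[/in_degreeP ci /eqP dc].
rewrite raddfB /= db dc subrr eqxx andbT; apply/in_degreeP => s si.
by rewrite dffunBE bi ?ci ?subrr.
Qed.
HB.instance Definition _ i :=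
  GRing.isZmodClosed.Build cochain (cocycle i) (cocycle_closed i).

Definition cocycles (i : nat) := {c : cochain | c \in cocycle i}.
HB.instance Definition _ i := SubChoice.on (cocycles i).
HB.instance Definition _ i := [SubChoice_isSubZmodule of cocycles i by <:].

(* The images of C^(i-1), where C^(-1) = 0 as no s satisfies #|s| + 1 = 0.    *)
Definition coboundary (i : nat) : {pred cocycles i} :=
  fun z => `[< exists b, (forall s, #|s|.+1 != i -> b s = 0) /\
                         differential b = val z >].

Fact coboundary_closed i : zmod_closed (@coboundary i).
Proof.
split=> [|y z /asboolP[b [bi db]] /asboolP[c [ci dc]]]; apply/asboolP.
  by exists 0; rewrite !raddf0; split=> // s _; exact: dffun0E.
exists (b - c); rewrite !raddfB /= db dc; split=> // s si.
by rewrite dffunBE bi ?ci ?subrr.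
Qed.
HB.instance Definition _ i :=
  GRing.isZmodClosed.Build (cocycles i) (@coboundary i) (@coboundary_closed i).

Definition cohomology (i : nat) := {ideal_quot (@coboundary i)}.
HB.instance Definition _ i := GRing.Zmodule.on (cohomology i).

End GraphCohomology.

Definition P3 : graph := @Graph 'I_3 3 (fun i => (i, ordS i)).

Definition poly_algebra (p : {poly int}) : comPzRingType :=
  ring_quot (ideal_gen [set p]).

Definition deriv_ideal (I : ideal {poly int}) : ideal {poly int} :=
  ideal_gen [set f^`() | f in [set f | f \in I]].

Definition gcd_deriv_degree (p : {poly int}) : nat :=
  let pQ : {poly rat} := map_poly intr p in (size (gcdp pQ pQ^`())).-1.

(* The sum over the distinct complex roots; it is finite for p != 0.          *)
Definition excess_multiplicity (p : {poly int}) : nat :=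
  let pC : {poly algC} := map_poly intr p in
  \big[addn/0%N]_(z \in [set z | root pC z]) (mup z pC).-1.

(* Main.v *)
(* Write A = Z[x]/I, mu for the multiplication of A and Omega = Z[x]/I',      *)
(* which is the module of Kaehler differentials of A. A cochain of degree 1   *)
(* of the triangle is a triple (u_0, u_1, u_2) in A (x) A; it is a cocycle if *)
(* all mu(u_r) agree, and the coboundaries are the sums of triples (ab (x) c, *)
(* bc (x) a, ca (x) b). With D(a (x) b) = a db, the map sending (u_0, u_1,    *)
(* u_2) to D(u_0) + D(u_1) + D(u_2) - d(mu(u_0)) kills coboundaries by the    *)
(* product rule for d(abc). Modulo coboundaries a cocycle is (0, 0, w) with   *)
(* mu(w) = 0, and the Leibniz rule shows that (0, 0, w) is a coboundary as    *)
(* soon as D(w) = 0; hence H^1 = Omega.                                       *)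
(*   For H^0, the common kernel of the edge maps m_r : A (x) A (x) A -> A (x) *)
(* A is computed in steps: m_0 is onto, m_1 maps ker m_0 onto ker mu, and m_2 *)
(* maps ker m_0 & ker m_1 onto ker mu & ker D. Counting dimensions over Q     *)
(* gives m^3 - m^2 - 2 (m^2 - m) + rank Omega. When p has a unit leading      *)
(* coefficient, H^0 is the set of integer points of a rational subspace,      *)
(* hence free by the Smith normal form.                                       *)

Require Import Defs.
From HB Require Import structures.
From mathcomp Require Import all_boot all_order all_algebra all_field.
From mathcomp.multinomials Require Import freeg.
From mathcomp Require Import boolp classical_sets fsbigop.
From mathcomp Require Import ring zify.

Set Implicit Arguments.
Unset Strict Implicit.
Unset Printing Implicit Defensive.

Import GRing.Theory Num.Theory.
Local Open Scope ring_scope.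
Local Open Scope quotient_scope.
Local Open Scope classical_set_scope.

(* [merge] alone would denote the merge of sorted sequences.                  *)
Local Notation merge := Defs.merge.

(** * Quotients and presentations *)

(** In degrees 0 and 1 the complex of the triangle is tensor calculus. A 0-cochain is an element of
    the tensor cube of [A], its differential consists of the three maps [edge_merge]
    ([differential_edge]), and a 1-cocycle is a triple in the tensor square whose entries have the
    same product ([cocycle1P]). So H^1 measures the failure to lift such a triple through all three
    edges at once. Two edges can always be lifted ([edge_merge_lift2]), because [edge_merge] has a
    section; what remains is an element of the kernel of [mult], taken modulo [third_edge_image].
    That subgroup contains the Leibniz relations ([kdiff_leibniz]), so over a quotient of Z[x] the
    obstruction reduces to a multiple g dx ([kdiff_deriv]), with f' dx = 0 for f in the ideal. The
    map a db to a b' of [kaehler_lift] shows that there are no further relations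
    ([kaehler_third_edge_image]).

    [triangle_H1] is phrased for any [J] that is least among the ideals containing the derivatives
    of [I]. It then applies both to [deriv_ideal] and, through [poly_deriv_ideal], to the ideal
    generated by p and p'. For nonzero p, the latter is generated over Q by gcd(p, p')
    ([rat_basis_deriv_quot]), and passing to this gcd lowers each root multiplicity by one
    ([mup_gcdp_deriv]).

    H^0 is the common kernel of the edge maps. The lifting facts behind H^1 also give the images of
    successive kernels, hence its dimension over Q ([triangle_kernel_span]). If the leading
    coefficient is a unit, [A] is free over Z, H^0 becomes the group of integer points of a rational
    subspace, and [lattice_iso] gives a basis. *)

Lemma inj_surj_bijective (U V : Type) (f : U -> V) :
  injective f -> (forall y, exists x, f x = y) -> bijective f.
Proof.
move=> f_inj /choice[g gK]; exists g => // x.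
by apply: f_inj; rewrite gK.
Qed.

Lemma additive_inj (U V : zmodType) (f : {additive U -> V}) :
  (forall x, f x = 0 -> x = 0) -> injective f.
Proof.
move=> f0 x y fxy; apply/eqP; rewrite -subr_eq0; apply/eqP/f0.
by rewrite raddfB fxy subrr.
Qed.

Lemma quot_iso (U V : zmodType) (S : zmodClosed U) (f : {additive U -> V}) :
    (forall y, exists x, f x = y) -> (forall x, (f x == 0) = (x \in S)) ->
  zmod_iso {ideal_quot S} V.
Proof.
move=> f_surj f_ker.
have fpi x : f (repr (\pi_{ideal_quot S} x)) = f x.
  apply/eqP; rewrite -subr_eq0 -raddfB f_ker.
  by rewrite Quotient.idealrBE reprK.
pose g (x : {ideal_quot S}) := f (repr x).
have gB : zmod_morphism g.
  move=> x y; rewrite /g -[x in LHS]reprK -[y in LHS]reprK -raddfB fpi.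
  by rewrite raddfB.
pose g' : {additive _ -> _} := HB.pack g (GRing.isZmodMorphism.Build _ _ g gB).
exists g'; apply: inj_surj_bijective => [|y].
  apply: additive_inj => x /eqP; rewrite -[g' x]/(f (repr x)) f_ker => xS.
  rewrite -[x]reprK; apply/eqP.
  rewrite -[X in _ == X](raddf0 \pi_{ideal_quot S}) -Quotient.idealrBE subr0.
  exact: xS.
have [x <-] := f_surj y; exists (\pi_{ideal_quot S} x); exact: fpi.
Qed.

Section IdealQuotientTheory.
Variables (R : comPzRingType) (I : ideal R).

Definition rq_class (x : R) : ring_quot I := \pi_{ideal_quot I} x.

Fact rq_class_is_zmod_morphism : zmod_morphism rq_class.
Proof. by move=> x y; rewrite /rq_class raddfB. Qed.
HB.instance Definition _ :=
  GRing.isZmodMorphism.Build R (ring_quot I) rq_class rq_class_is_zmod_morphism.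

Fact rq_class_is_monoid_morphism : monoid_morphism rq_class.
Proof. by split=> [//|x y]; rewrite -[LHS](rq_mul_pi I). Qed.
HB.instance Definition _ :=
  GRing.isMonoidMorphism.Build R (ring_quot I) rq_class
    rq_class_is_monoid_morphism.

Lemma rq_classD x y : rq_class (x + y) = rq_class x + rq_class y.
Proof. exact: raddfD. Qed.

Lemma rq_classB x y : rq_class (x - y) = rq_class x - rq_class y.
Proof. exact: raddfB. Qed.

Lemma rq_classM x y : rq_class (x * y) = rq_class x * rq_class y.
Proof. exact: rmorphM. Qed.

Lemma rq_class_eq x y : (rq_class x == rq_class y) = (x - y \in I).
Proof. by rewrite Quotient.idealrBE. Qed.

Lemma rq_class_eq0 x : (rq_class x == 0) = (x \in I).
Proof. by rewrite -(raddf0 rq_class) rq_class_eq subr0. Qed.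

Lemma rq_classK : cancel (repr : ring_quot I -> R) rq_class.
Proof. exact: reprK. Qed.

End IdealQuotientTheory.

Lemma ideal_genS (R : pzRingType) (S : set R) x : S x -> x \in ideal_gen S.
Proof. by move=> Sx; apply/ideal_genP => J; apply. Qed.

Lemma present_ind (T : choiceType) (S : set {freeg T})
    (P : present S -> Prop) :
    P 0 -> (forall x y, P x -> P y -> P (x - y)) -> (forall t, P (pgen S t)) ->
  forall x, P x.
Proof.
move=> P0 PB Pp x.
have PN y : P y -> P (- y) by move=> Py; rewrite -sub0r; apply: PB.
have PD y z : P y -> P z -> P (y + z).
  by move=> Py Pz; rewrite -[z]opprK; apply/PB/PN.
rewrite -[x]reprK -(freeg_sumE (repr x)) raddf_sum.
elim/big_ind: _ => // t _.
have -> : << coeff t (repr x) *g t >> = fgen t *~ coeff t (repr x).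
  by rewrite /fgen freeg_mulz intz.
rewrite raddfMz -[X in P (X *~ _)]/(pgen S t).
have Pn n : P (pgen S t *+ n).
  by elim: n => [|n IHn]; rewrite ?mulr0n // mulrS; apply: PD.
by case: (coeff _ _) => n; [apply: Pn | rewrite NegzE mulrNz; apply/PN/Pn].
Qed.

Section TensorTheory.
Variables (A : zmodType) (K : finType).
Implicit Types (f : {ffun K -> A}) (k : K).

Lemma pureD f k a b :
  pure (fset_at f k (a + b)) = pure (fset_at f k a) + pure (fset_at f k b).
Proof.
apply/eqP; rewrite -subr_eq0 -raddfD -raddfB; apply/eqP/pi_rel.
by exists f, k, a, b.
Qed.

Lemma pure_at_is_zmod_morphism f k :
  zmod_morphism (fun a => pure (fset_at f k a)).
Proof.
by move=> a b; apply/eqP; rewrite eq_sym subr_eq -pureD subrK.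
Qed.

Lemma tensor_lift (M : zmodType) (g : {ffun K -> A} -> M) :
    (forall f k a b,
       g (fset_at f k (a + b)) = g (fset_at f k a) + g (fset_at f k b)) ->
  exists F : {additive tensor_power A K -> M}, forall f, F (pure f) = g f.
Proof.
move=> gD.
have gS r : @tensor_rel A K r -> fglin g r = 0.
  by move=> [f [k [a [b ->]]]]; rewrite raddfB raddfD /= !fglinE gD subrr.
pose F : {additive _ -> _} := HB.pack (plift g : tensor_power A K -> M)
  (GRing.isZmodMorphism.Build _ _ _ (plift_is_zmod_morphism gS)).
by exists F => f; exact: (plift_gen gS).
Qed.

Lemma tensor_ind (P : tensor_power A K -> Prop) :
    P 0 -> (forall x y, P x -> P y -> P (x - y)) -> (forall f, P (pure f)) ->
  forall x, P x.
Proof.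
exact: present_ind.
Qed.

End TensorTheory.

Lemma fset_at_id (A : zmodType) (K : finType) (f : {ffun K -> A}) k :
  fset_at f k (f k) = f.
Proof. by apply/ffunP => j; rewrite ffunE; case: eqP => // ->. Qed.

Lemma merge_id (A : comPzRingType) (K : finType) (h : K -> K)
    (x : tensor_power A K) : h =1 id -> merge h x = x.
Proof.
move=> hE; elim/tensor_ind: x => [|x y fx fy|f]; first by rewrite raddf0.
  by rewrite raddfB /= fx fy.
rewrite merge_pure; congr pure; apply/ffunP => k; rewrite ffunE.
rewrite (big_pred1 k) // => j; exact: (congr1 (fun z => z == k) (hE j)).
Qed.

Lemma eq_merge (A : comPzRingType) (K L : finType) (g h : K -> L)
    (x : tensor_power A K) : g =1 h -> merge g x = merge h x.
Proof. by move=> gh; congr (merge _ x); apply: funext. Qed.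

(** * Tensor powers of the triangle *)

(** Edge [r] joins the vertices [r] and [ordS r]; this is the third vertex. *)
Definition opposite (r : 'I_3) : 'I_3 := ordS (ordS r).

Lemma sum_edges (V : nmodType) (F : 'I_3 -> V) :
  \sum_r F r = F ord0 + F (ordS ord0) + F (opposite ord0).
Proof.
rewrite !big_ord_recl big_ord0 addr0 addrA.
by congr (F _ + F _ + F _); apply: val_inj.
Qed.

Section Triangle.
Variable A : comPzRingType.
Implicit Types (r : 'I_3) (a b c : A).

(* The factor [true] belongs to the vertex opposite to the edge [r], and the  *)
(* factor [false] to the merged endpoints [r] and [ordS r].                   *)
Definition edge_merge r : tensor_power A 'I_3 -> tensor_power A bool :=
  merge (fun y => y == opposite r).
HB.instance Definition _ r :=
  GRing.Additive.on (edge_merge r).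

(** No factor is sent to the vertex [ordS r], which therefore receives an empty product, that is,
    the unit. *)
Definition edge_section r : tensor_power A bool -> tensor_power A 'I_3 :=
  merge (fun k : bool => if k then opposite r else r).
HB.instance Definition _ r :=
  GRing.Additive.on (edge_section r).

Definition mult : tensor_power A bool -> tensor_power A unit :=
  merge (fun=> tt).
HB.instance Definition _ :=
  GRing.Additive.on mult.

(** The map from a to a (x) 1: the factor [true] is again an empty product. *)
Definition insert1 : tensor_power A unit -> tensor_power A bool :=
  merge (fun=> false).
HB.instance Definition _ :=
  GRing.Additive.on insert1.

Lemma edge_sectionK r : cancel (edge_section r) (edge_merge r).
Proof.
move=> u; rewrite /edge_merge /edge_section merge_comp merge_id // => k.
by case: r => -[|[|[|//]]] ?; case: k.
Qed.

Lemma edge_merge_ordS_section r u :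
  edge_merge (ordS r) (edge_section r u) = merge negb u.
Proof.
rewrite /edge_merge /edge_section merge_comp; apply: eq_merge => k.
by case: r => -[|[|[|//]]] ?; case: k.
Qed.

Lemma edge_merge_opposite_section r u :
  edge_merge (opposite r) (edge_section r u) = insert1 (mult u).
Proof.
rewrite /edge_merge /edge_section /insert1 /mult !merge_comp.
by apply: eq_merge => k; case: r => -[|[|[|//]]] ?; case: k.
Qed.

Lemma mult_edge_merge r t : mult (edge_merge r t) = merge (fun=> tt) t.
Proof. by rewrite /mult /edge_merge merge_comp. Qed.

Lemma mult_insert1 x : mult (insert1 x) = x.
Proof. by rewrite /mult /insert1 merge_comp merge_id // => -[]. Qed.

Lemma mult_negb u : mult (merge negb u) = mult u.
Proof. by rewrite /mult merge_comp. Qed.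

(** The section of edge 0 lifts the first entry. The error [v] on edge 1 has product zero, so
    lifting it by the section of edge 1 changes edge 0 only by [insert1 (mult v) = 0]. *)
Lemma edge_merge_lift2 (u : 'I_3 -> tensor_power A bool) :
    (forall r, mult (u r) = mult (u ord0)) ->
  exists t, [/\ u ord0 = edge_merge ord0 t,
    u (ordS ord0) = edge_merge (ordS ord0) t &
    mult (u (opposite ord0) - edge_merge (opposite ord0) t) = 0].
Proof.
move=> uE; pose v := u (ordS ord0) - merge negb (u ord0).
have v0 : mult v = 0 by rewrite raddfB /= mult_negb uE subrr.
exists (edge_section ord0 (u ord0) + edge_section (ordS ord0) v); split.
- rewrite raddfD /= edge_sectionK.
  have -> : edge_merge ord0 = edge_merge (opposite (ordS ord0)).
    by congr edge_merge; apply: val_inj.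
  by rewrite edge_merge_opposite_section v0 raddf0 addr0.
- rewrite raddfD /= edge_sectionK edge_merge_ordS_section.
  by rewrite addrC subrK.
rewrite raddfB raddfD /= raddfD /= !mult_edge_merge.
have E r x : merge (fun=> tt) (edge_section r x) = mult x.
  by rewrite /edge_section merge_comp.
by rewrite !E v0 addr0 uE subrr.
Qed.

Definition pure2 a b : tensor_power A bool :=
  pure [ffun k : bool => if k then b else a].

Definition pure3 a b c : tensor_power A 'I_3 :=
  pure [ffun k => if k == ord0 then a else if k == ordS ord0 then b else c].

Lemma pure2E (f : {ffun bool -> A}) : pure f = pure2 (f false) (f true).
Proof. by congr pure; apply/ffunP => -[]; rewrite ffunE. Qed.

Lemma pure3E (f : {ffun 'I_3 -> A}) :
  pure f = pure3 (f ord0) (f (ordS ord0)) (f (opposite ord0)).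
Proof.
congr pure; apply/ffunP => k; rewrite ffunE.
by case: k => -[|[|[|//]]] ?; congr (f _); apply: val_inj.
Qed.

Lemma pure2Br a : zmod_morphism (pure2 a).
Proof.
move=> b c; pose f := [ffun k : bool => if k then 0 else a].
have E x : pure2 a x = pure (fset_at f true x).
  by congr pure; apply/ffunP => -[]; rewrite !ffunE.
by rewrite !E pure_at_is_zmod_morphism.
Qed.

Lemma pure2Bl b : zmod_morphism (pure2^~ b).
Proof.
move=> a c; pose f := [ffun k : bool => if k then b else 0].
have E x : pure2 x b = pure (fset_at f false x).
  by congr pure; apply/ffunP => -[]; rewrite !ffunE.
by rewrite !E pure_at_is_zmod_morphism.
Qed.

HB.instance Definition _ a :=
  GRing.isZmodMorphism.Build A (tensor_power A bool) (pure2 a) (pure2Br a).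

Definition pure2l b a := pure2 a b.
HB.instance Definition _ b :=
  GRing.isZmodMorphism.Build A (tensor_power A bool) (pure2l b) (pure2Bl b).

Lemma pure2lE a b : pure2 a b = pure2l b a. Proof. by []. Qed.

Lemma edge_merge_pure3 a b c :
  [/\ edge_merge ord0 (pure3 a b c) = pure2 (a * b) c,
      edge_merge (ordS ord0) (pure3 a b c) = pure2 (b * c) a &
      edge_merge (opposite ord0) (pure3 a b c) = pure2 (c * a) b].
Proof.
split; rewrite [LHS]merge_pure pure2E; congr pure2; rewrite ffunE big_mkcond;
  by rewrite !big_ord_recl big_ord0 !ffunE /= ?(mulr1, mul1r) // mulrC.
Qed.

Lemma merge_tt_pure3 a b c :
  merge (fun=> tt) (pure3 a b c) = pure [ffun=> a * b * c].
Proof.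
rewrite merge_pure; congr pure; apply/ffunP => -[]; rewrite !ffunE.
by rewrite !big_ord_recl big_ord0 !ffunE /= mulr1 mulrA.
Qed.

Lemma mult_pure2 a b : mult (pure2 a b) = pure [ffun=> a * b].
Proof.
rewrite [LHS]merge_pure; congr pure; apply/ffunP => -[]; rewrite !ffunE.
by rewrite (bigD1 true) //= (big_pred1 false) ?ffunE 1?mulrC // => -[].
Qed.

Lemma insert1_pure a : insert1 (pure [ffun=> a]) = pure2 a 1.
Proof.
rewrite [LHS]merge_pure; congr pure; apply/ffunP => -[]; rewrite !ffunE.
  by rewrite big_pred0.
by rewrite (big_pred1 tt) ?ffunE // => -[].
Qed.

(** Says that the triple (0, 0, w) is a coboundary. *)
Definition third_edge_image (w : tensor_power A bool) : Prop :=
  exists t, [/\ edge_merge ord0 t = 0, edge_merge (ordS ord0) t = 0 &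
                edge_merge (opposite ord0) t = w].

Lemma third_edge_imageB v w :
  third_edge_image v -> third_edge_image w -> third_edge_image (v - w).
Proof.
move=> [s [s0 s1 <-]] [t [t0 t1 <-]]; exists (s - t).
by rewrite !raddfB /= s0 s1 t0 t1 subrr.
Qed.

Lemma third_edge_image0 : third_edge_image 0.
Proof. by exists 0; rewrite !raddf0. Qed.

Lemma third_edge_imageN v : third_edge_image v -> third_edge_image (- v).
Proof. by rewrite -[- v]sub0r; apply/third_edge_imageB/third_edge_image0. Qed.

Lemma third_edge_imageD v w :
  third_edge_image v -> third_edge_image w -> third_edge_image (v + w).
Proof.
by move=> vW wW; rewrite -[w]opprK; apply/third_edge_imageB/third_edge_imageN.
Qed.

(* Represents the Kaehler differential [a db].                                *)
Definition kdiff a b := pure2 a b - pure2 (a * b) 1.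

Lemma kdiff_is_zmod_morphism a : zmod_morphism (kdiff a).
Proof.
move=> b c; rewrite /kdiff mulrBr raddfB !(pure2lE _ 1) raddfB /=.
by rewrite !opprD !opprK addrACA.
Qed.
HB.instance Definition _ a :=
  GRing.isZmodMorphism.Build A (tensor_power A bool) (kdiff a)
    (kdiff_is_zmod_morphism a).

Lemma kdiffDl a b c : kdiff (a + b) c = kdiff a c + kdiff b c.
Proof.
by rewrite /kdiff mulrDl !pure2lE !raddfD addrACA.
Qed.

Lemma kdiffBl a b c : kdiff (a - b) c = kdiff a c - kdiff b c.
Proof. by apply/eqP; rewrite eq_sym subr_eq -kdiffDl subrK. Qed.

Lemma kdiff0l a : kdiff 0 a = 0.
Proof. by apply: (addIr (kdiff 0 a)); rewrite add0r -kdiffDl addr0. Qed.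

Lemma mult_kdiff a b : mult (kdiff a b) = 0.
Proof. by rewrite /kdiff raddfB /= !mult_pure2 mulr1 subrr. Qed.

Lemma kdiff1 a : kdiff a 1 = 0.
Proof. by rewrite /kdiff mulr1 subrr. Qed.

Lemma kdiff_leibniz a b c :
  third_edge_image (kdiff a (b * c) - (kdiff (a * b) c + kdiff (a * c) b)).
Proof.
(* The terms cancel in pairs on the first two edges, and the third edge sends them to a (x) bc - ab
   (x) c - ac (x) b + abc (x) 1. *)
exists (pure3 a (b * c) 1 - pure3 (a * b) c 1 - pure3 a b c
        + pure3 (a * b) 1 c).
have [x0 x1 x2] := edge_merge_pure3 a (b * c) 1.
have [y0 y1 y2] := edge_merge_pure3 (a * b) c 1.
have [z0 z1 z2] := edge_merge_pure3 a b c.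
have [t0 t1 t2] := edge_merge_pure3 (a * b) 1 c.
split; rewrite raddfD 2!raddfB /= ?x0 ?x1 ?x2 ?y0 ?y1 ?y2 ?z0 ?z1 ?z2
  ?t0 ?t1 ?t2 ?mulr1 ?mul1r.
- by rewrite !mulrA subrr add0r addNr.
- by rewrite addrAC subrK subrr.
rewrite /kdiff !mulrA (mulrC c a) (mulrAC a c b).
set x := pure2 a _; set y := pure2 (a * b) c; set z := pure2 (a * c) b.
set t := pure2 _ 1.
by rewrite opprD !opprB !addrA subrK (addrAC _ (- z)).
Qed.

End Triangle.

(** * Kaehler differentials *)

Section KdiffXNull.
Variable I : ideal {poly int}.

(** The annihilator of dx modulo [third_edge_image]. Quantifying over [a] makes it an ideal, so that
    the minimality of [J] can be applied to it. *)
Definition kdiffX_null : {pred {poly int}} := fun g =>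
  `[< forall a : ring_quot I,
        third_edge_image (kdiff (a * rq_class I g) (rq_class I 'X)) >].

Fact kdiffX_null_closed : zmod_closed kdiffX_null.
Proof.
split=> [|f g /asboolP fK /asboolP gK]; apply/asboolP => a.
  by rewrite raddf0 mulr0 kdiff0l; exact: third_edge_image0.
have := third_edge_imageB (fK a) (gK a).
by rewrite -kdiffBl -mulrBr -rq_classB.
Qed.
HB.instance Definition _ :=
  GRing.isZmodClosed.Build {poly int} kdiffX_null kdiffX_null_closed.

Fact kdiffX_null_absorbing a :
  {in kdiffX_null, forall g, a * g \in kdiffX_null}.
Proof.
move=> g /asboolP gK; apply/asboolP => b.
by rewrite rq_classM mulrA; exact: gK.
Qed.
HB.instance Definition _ :=
  isMulAbsorbing.Build {poly int} kdiffX_null kdiffX_null_absorbing.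

End KdiffXNull.

Section KaehlerDifferentials.
Variables I J : ideal {poly int}.
Hypothesis IJ : {subset I <= J}.
Hypothesis dIJ : forall f, f \in I -> f^`() \in J.
Local Notation A := (ring_quot I : comPzRingType).
Local Notation B := (ring_quot J : comPzRingType).
Local Notation "[ f ]I" := (rq_class I f) (format "[ f ]I").
Local Notation "[ f ]J" := (rq_class J f) (format "[ f ]J").

Lemma eq_class_deriv f g : [f]I = [g]I -> [f^`()]J = [g^`()]J.
Proof.
move/eqP; rewrite rq_class_eq => fg.
by apply/eqP; rewrite rq_class_eq -derivB dIJ.
Qed.

Lemma eq_class_sub f g : [f]I = [g]I -> [f]J = [g]J.
Proof.
by move/eqP; rewrite rq_class_eq => fg; apply/eqP; rewrite rq_class_eq IJ.
Qed.

(** The map a (x) b to a db, with dx sent to 1. Another representative changes f by an element of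
    [I], which lies in [J], and g' by the derivative of an element of [I], which also lies in
    [J]. *)
Lemma kaehler_lift :
  exists D : {additive tensor_power A bool -> B},
    forall f g, D (pure2 [f]I [g]I) = [f * g^`()]J.
Proof.
pose d (f : {ffun bool -> A}) : B := [repr (f false) * (repr (f true))^`()]J.
have dE f g h : h = [ffun k : bool => if k then [g]I else [f]I] ->
    d h = [f * g^`()]J.
  move=> ->; rewrite /d !ffunE !rmorphM; congr (_ * _).
    by apply: eq_class_sub; rewrite rq_classK.
  by apply: eq_class_deriv; rewrite rq_classK.
have [|D DE] := @tensor_lift A bool B d.
  move=> f k a b.
  have E c : fset_at f k c = [ffun j : bool => if j
      then [if k then repr c else repr (f true)]I
      else [if k then repr (f false) else repr c]I].
    by apply/ffunP => -[]; rewrite !ffunE; case: (k); rewrite rq_classK.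
  have Eab : fset_at f k (a + b) = [ffun j : bool => if j
      then [if k then repr a + repr b else repr (f true)]I
      else [if k then repr (f false) else repr a + repr b]I].
    rewrite E; apply/ffunP => -[]; rewrite !ffunE; case: (k);
    by rewrite ?raddfD /= ?rq_classK.
  rewrite (dE _ _ _ (E a)) (dE _ _ _ (E b)) (dE _ _ _ Eab) -raddfD.
  by case: (k); rewrite ?derivD ?mulrDr ?mulrDl.
by exists D => f g; rewrite DE; apply: dE.
Qed.

Lemma deriv_lift :
  exists delta : {additive tensor_power A unit -> B},
    forall f, delta (pure [ffun=> [f]I]) = [f^`()]J.
Proof.
pose d (f : {ffun unit -> A}) : B := [(repr (f tt))^`()]J.
have [|D DE] := @tensor_lift A unit B d.
  move=> f [] a b; rewrite /d !ffunE /= -raddfD -derivD.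
  by apply: eq_class_deriv; rewrite raddfD /= !rq_classK.
exists D => f; rewrite DE /d ffunE.
by apply: eq_class_deriv; rewrite rq_classK.
Qed.

Variable D : {additive tensor_power A bool -> B}.
Hypothesis DE : forall f g, D (pure2 [f]I [g]I) = [f * g^`()]J.

Lemma kaehler_kdiffX g : D (kdiff [g]I ['X]I) = [g]J.
Proof.
rewrite /kdiff raddfB /= -[1]/[1]I -rq_classM !DE.
by rewrite derivX derivC mulr1 mulr0 raddf0 subr0.
Qed.

Lemma classP (a : A) : exists f, a = [f]I.
Proof. by exists (repr a); rewrite rq_classK. Qed.

(* This is the product rule [d(abc) = ab dc + bc da + ca db].                 *)
Lemma sum_kaehler_edges (delta : {additive tensor_power A unit -> B}) :
    (forall f, delta (pure [ffun=> [f]I]) = [f^`()]J) ->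
  forall t, \sum_r D (edge_merge r t) = delta (merge (fun=> tt) t).
Proof.
move=> deltaE; elim/tensor_ind => [|x y fx fy|f].
- by rewrite raddf0 raddf0 big1 // => r _; rewrite !raddf0.
- rewrite [in RHS]raddfB raddfB /= -fx -fy -sumrB.
  by apply: eq_bigr => r _; rewrite !raddfB.
rewrite pure3E.
have [a ->] := classP (f ord0); have [b ->] := classP (f (ordS ord0)).
have [c ->] := classP (f (opposite ord0)).
have [E0 E1 E2] := edge_merge_pure3 [a]I [b]I [c]I.
rewrite sum_edges E0 E1 E2 merge_tt_pure3 -!rmorphM !DE deltaE -!raddfD.
by congr [_]J; rewrite !derivM; ring.
Qed.

(** The chain rule a df = a f' dx. By induction on [f]: constants have zero differential because
    they are integer multiples of 1, and the Leibniz rule handles the product with X. *)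
Lemma kdiff_deriv (a : A) f :
  third_edge_image (kdiff a [f]I - kdiff (a * [f^`()]I) ['X]I).
Proof.
have kdiffC (b : A) (c : int) : kdiff b [c%:P]I = 0.
  rewrite -[c]intz rmorph_int rmorph_int.
  by rewrite -[c%:~R]/(1 *~ c) raddfMz /= kdiff1 mul0rz.
elim/poly_ind: f a => [|f c IHf] a.
  rewrite linear0 raddf0 mulr0 kdiff0l raddf0 subr0.
  exact: third_edge_image0.
rewrite raddfD /= raddfD /= kdiffC addr0.
rewrite derivD derivC addr0 derivM derivX mulr1.
have -> : [f^`() * 'X + f]I = [f^`()]I * ['X]I + [f]I.
  by rewrite rq_classD rq_classM.
have -> : [f * 'X]I = [f]I * ['X]I by rewrite rq_classM.
rewrite mulrDr kdiffDl.
have aE : a * ([f^`()]I * ['X]I) = a * ['X]I * [f^`()]I.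
  by rewrite mulrA mulrAC.
rewrite aE; have := kdiff_leibniz a [f]I ['X]I; have := IHf (a * ['X]I).
move=> W1 W2; have := third_edge_imageD W2 W1.
suff E (V : zmodType) (u v x y : V) : u - (v + x) + (x - y) = u - (y + v).
  by rewrite E.
by rewrite opprD addrA addrA subrK (addrC y) opprD addrA.
Qed.

Hypothesis Jmin :
  forall K : ideal {poly int}, (forall f, f \in I -> f^`() \in K) ->
  {subset J <= K}.

Lemma kdiffX_null_sub : {subset J <= kdiffX_null I}.
Proof.
apply: Jmin => f fI; apply/asboolP => a.
have /third_edge_imageN := kdiff_deriv a f.
have -> : [f]I = 0 by apply/eqP; rewrite rq_class_eq0.
by rewrite raddf0 sub0r opprK.
Qed.

Lemma kaehler_third_edge_image w :
  mult w = 0 -> D w = 0 -> third_edge_image w.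
Proof.
(* Every w equals mu(w) (x) 1 + g dx modulo [third_edge_image], where g represents [D w]. If
   [D w = 0] then g lies in [J], so g dx vanishes too. *)
suff [g [Dw]] : exists g, D w = [g]J /\
    third_edge_image (w - insert1 (mult w) - kdiff [g]I ['X]I).
  move=> W m0 D0; move: W; rewrite m0 raddf0 subr0 => W.
  rewrite -[w](subrK (kdiff [g]I ['X]I)); apply: third_edge_imageD => //.
  have /kdiffX_null_sub/asboolP/(_ 1) : g \in J by rewrite -rq_class_eq0 -Dw D0.
  by rewrite mul1r.
elim/tensor_ind: w => [|x y [f [Dx Wx]] [g [Dy Wy]]|f].
- exists 0; rewrite !raddf0 kdiff0l subr0 addr0; split=> //.
  exact: third_edge_image0.
- exists (f - g); split; first by rewrite raddfB Dx Dy rq_classB.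
  have := third_edge_imageB Wx Wy.
  rewrite rq_classB kdiffBl [mult (x - y)]raddfB [insert1 (_ - _)]raddfB /=.
  have E (V : zmodType) (u v s t : V) : u - v - (s - t) = u - s - (v - t).
    by rewrite !opprB addrACA [RHS]addrACA [- v - s]addrC.
  by rewrite E [x - _ - _]E.
rewrite pure2E.
have [a ->] := classP (f false); have [b ->] := classP (f true).
exists (a * b^`()); rewrite DE; split=> //.
by rewrite mult_pure2 insert1_pure rq_classM; exact: kdiff_deriv.
Qed.

End KaehlerDifferentials.

(** * Components of the subgraphs of the triangle *)

Section TriangleComponents.
Implicit Types (s : {set 'I_3}) (r q x y : 'I_3).
Local Notation comp s := (@component_of P3 s).

Lemma triangle_cases r y : [\/ y = r, y = ordS r | y = opposite r].
Proof.
case: r y => -[|[|[|//]]] ? [[|[|[|//]]] ?];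
by [apply: Or31; apply: val_inj | apply: Or32; apply: val_inj
   | apply: Or33; apply: val_inj].
Qed.

Lemma opposite_neq r : (r == opposite r) = false.
Proof. by case: r => -[|[|[|//]]] ?. Qed.

Lemma ordS_neq_opposite r : (ordS r == opposite r) = false.
Proof. by case: r => -[|[|[|//]]] ?. Qed.

Lemma eq_component_of s x y :
  (comp s x == comp s y) = connect (@adj P3 s) x y.
Proof.
by rewrite -val_eqE /= root_connect //; exact: (@connect_adj_sym P3 s).
Qed.

Lemma connect_edge s r : r \in s -> connect (@adj P3 s) r (ordS r).
Proof.
by move=> rs; apply/connect1/exists_inP; exists r; rewrite ?eqxx.
Qed.

Lemma connect_set0 x y : connect (@adj P3 finset.set0) x y = (x == y).
Proof.
apply/idP/eqP => [/connectP[[|z p] /=]|->]; last exact: connect0.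
  by move=> _ ->.
by case/andP => /exists_inP[e]; rewrite finset.inE.
Qed.

Lemma connect_opposite r y :
  connect (@adj P3 [set r]%SET) (opposite r) y = (y == opposite r).
Proof.
apply/idP/eqP => [/connectP[[|z p] /=]|->]; last exact: connect0.
  by move=> _ ->.
case/andP => /exists_inP[e]; rewrite finset.inE => /eqP -> /=.
by rewrite /eq_op /= opposite_neq ordS_neq_opposite andbF.
Qed.

(** Indexes the two components left by the single edge [r] in the same way as the factors of
    [edge_merge r]. *)
Definition edge_component r (k : bool) : component (G := P3) [set r]%SET :=
  comp [set r]%SET (if k then opposite r else r).

Definition edge_component_inv r (c : component (G := P3) [set r]%SET) : bool :=
  val c == opposite r.

Lemma component_of_edge r y :
  comp [set r]%SET y = edge_component r (y == opposite r).
Proof.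
have [->|->|->] := triangle_cases r y; rewrite ?eqxx //.
  by rewrite opposite_neq.
rewrite ordS_neq_opposite; apply/eqP; rewrite eq_sym eq_component_of.
by rewrite connect_edge // finset.inE.
Qed.

Lemma edge_componentK r :
  cancel (edge_component r) (edge_component_inv (r := r)).
Proof.
have symr := @connect_adj_sym P3 [set r]%SET.
rewrite /edge_component_inv => k; rewrite -connect_opposite symr.
rewrite -root_connect // /edge_component /= root_root // root_connect //.
by rewrite symr connect_opposite; case: k; rewrite ?eqxx ?opposite_neq.
Qed.

Lemma edge_component_invK r :
  cancel (edge_component_inv (r := r)) (edge_component r).
Proof.
move=> c; have -> : c = comp [set r]%SET (val c).
  apply: val_inj => /=; apply/esym/eqP; exact: (valP c).
by rewrite component_of_edge edge_componentK.
Qed.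

Lemma component_of_pair s r q x y :
  r \in s -> q \in s -> r != q -> comp s x = comp s y.
Proof.
(* Of two distinct edges of a triangle, one is the cyclic successor of the other. *)
wlog qr : r q / q = ordS r => [W|] rs qs nrq.
  have [E|E|E] := triangle_cases r q; first by rewrite E eqxx in nrq.
    exact: (W r q).
  apply: (W q r); rewrite 1?eq_sym // E.
  by apply: val_inj; case: (r) => -[|[|[|//]]] ?.
suff E z : comp s z = comp s r by rewrite !E.
apply/eqP; rewrite eq_sym eq_component_of.
have C1 := connect_edge rs; have C2 := connect_edge qs.
have [->|->|->] := triangle_cases r z; rewrite ?connect0 //.
by apply: connect_trans C1 _; rewrite /opposite -qr.
Qed.

End TriangleComponents.

(** * The cochain complex of the triangle *)

Section TriangleComplex.
Variable A : comPzRingType.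
Implicit Types (s : {set 'I_3}) (r q : 'I_3).
Local Notation comp s := (@component_of P3 s).
Local Notation smap s t := (@state_map A P3 s t).
Local Notation d := (@differential A P3).
Local Notation cochain := (cochain A P3).
Implicit Types b c z : cochain.

Definition vertex_part c : tensor_power A 'I_3 :=
  merge (fun x : component (G := P3) finset.set0 => val x) (c finset.set0).

Fact edge_part_key : unit. Proof. by []. Qed.
(* Locked: unifying components of distinct edges would take forever to fail.  *)
Definition edge_part : cochain -> 'I_3 -> tensor_power A bool :=
  locked_with edge_part_key (fun c r =>
    merge (edge_component_inv (r := r)) (c [set r]%SET)).

Lemma edge_partE c r :
  edge_part c r = merge (edge_component_inv (r := r)) (c [set r]%SET).
Proof. by rewrite /edge_part; case: edge_part_key. Qed.

Lemma vertex_partB b c : vertex_part (b - c) = vertex_part b - vertex_part c.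
Proof. by rewrite /vertex_part dffunBE raddfB. Qed.

Lemma edge_partB b c r : edge_part (b - c) r = edge_part b r - edge_part c r.
Proof. by rewrite !edge_partE dffunBE raddfB. Qed.

Lemma vertex_partK c : c finset.set0 = merge (comp finset.set0) (vertex_part c).
Proof.
rewrite /vertex_part merge_comp merge_id // => x.
by apply/eqP; rewrite -val_eqE /=; exact: (valP x).
Qed.

Lemma edge_partK c r : c [set r]%SET = merge (edge_component r) (edge_part c r).
Proof.
by rewrite edge_partE merge_comp merge_id // => x; exact: edge_component_invK.
Qed.

Definition cochain0 (t : tensor_power A 'I_3) : cochain :=
  [ffun s => if s == finset.set0 then merge (comp s) t else 0
     : tensor_state A s].

(** The type of the value depends on [s]. Writing each guarded term with components of [s] itself
    avoids transporting along [s = [set r]]. *)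
Definition cochain1 (u : 'I_3 -> tensor_power A bool) : cochain :=
  [ffun s : {set 'I_(nb_edges P3)} => \sum_r if s == [set r]%SET
      then merge (fun k : bool => comp s (if k then opposite r else r)) (u r)
      else 0 : tensor_state A s].

Lemma vertex_part_cochain0 t : vertex_part (cochain0 t) = t.
Proof.
rewrite /vertex_part ffunE eqxx merge_comp merge_id // => x /=.
by apply/eqP; rewrite eq_sym -connect_set0 connect_root.
Qed.

Lemma edge_part_cochain1 u r : edge_part (cochain1 u) r = u r.
Proof.
rewrite edge_partE ffunE (bigD1 r) //= eqxx big1 ?addr0 => [|q /negPf qr].
  by rewrite merge_comp merge_id // => k; exact: edge_componentK.
by case: eqP => // /finset.set1_inj rq; rewrite rq eqxx in qr.
Qed.

Lemma cochain0_degree t s : #|s| != 0 -> cochain0 t s = 0.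
Proof. by rewrite cards_eq0 => /negPf s0; rewrite ffunE s0. Qed.

Lemma cochain1_degree u : cochain1 u \in in_degree 1.
Proof.
apply/in_degreeP => s s1; rewrite ffunE big1 // => r _.
by case: eqP => // sr; rewrite sr cards1 in s1.
Qed.

Lemma differential_edge c r : edge_part (d c) r = edge_merge r (vertex_part c).
Proof.
rewrite edge_partE ffunE (big_pred1 r) => [|q]; last by rewrite finset.inE.
rewrite finset.setDv /=.
have -> : #|[set q in (finset.set0 : {set 'I_3}) | (q < r)%N]%SET| = 0%N.
  by apply: eq_card0 => q; rewrite !finset.inE.
rewrite expr0 mulr1z vertex_partK; move: (vertex_part c) => t.
rewrite /state_map !merge_comp; apply: eq_merge => x.
rewrite -[RHS](edge_componentK r) -component_of_edge /=.
congr edge_component_inv.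
by apply: (@component_of_val P3); exact: finset.sub0set.
Qed.

(** Two edges connect the whole triangle, so each contribution is a full product. Adding [r] to [q]
    crosses no smaller edge, while adding [q] to [r] crosses one; hence the difference. *)
Lemma differential_pair c r q : (r < q)%N ->
  d c [set r; q]%SET =
  merge (fun=> comp [set r; q]%SET ord0)
    (mult (edge_part c q) - mult (edge_part c r)).
Proof.
move=> rq; have nrq : r != q by rewrite -val_eqE /= ltn_eqF.
have E p : p \in [set r; q]%SET ->
    smap [set p]%SET [set r; q]%SET (c [set p]%SET)
    = merge (fun=> comp [set r; q]%SET ord0) (mult (edge_part c p)).
  move=> _; rewrite edge_partK; move: (edge_part c p) => u.
  rewrite /state_map /mult !merge_comp; apply: eq_merge => k.
  by apply: (component_of_pair (r := r) (q := q));
    rewrite // !finset.inE eqxx ?orbT.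
rewrite ffunE finset.big_setU1 ?finset.inE //= finset.big_set1.
have -> : ([set r; q] :\ r)%SET = [set q]%SET.
  by rewrite finset.setU1K // finset.inE.
have -> : ([set r; q] :\ q)%SET = [set r]%SET.
  by rewrite finset.setUC finset.setU1K // finset.inE eq_sym.
rewrite !E ?finset.inE ?eqxx ?orbT //.
have -> : #|[set p in [set q] | (p < r)%N]%SET| = 0%N.
  apply: eq_card0 => p; rewrite !finset.inE; case: eqP => //= ->.
  by rewrite ltnNge ltnW.
have -> : #|[set p in [set r] | (p < q)%N]%SET| = 1%N.
  apply: etrans (cards1 r); apply: eq_card => p; rewrite !finset.inE.
  by case: eqP => //= ->.
by rewrite expr0 expr1 [RHS]raddfB; congr (_ + _).
Qed.

Lemma cocycle1P z : z \in in_degree 1 ->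
  reflect (forall r, mult (edge_part z r) = mult (edge_part z ord0))
          (z \in cocycle 1).
Proof.
move=> z1; rewrite [z \in cocycle 1]/(_ && _) z1 /=.
apply: (iffP eqP) => [dz r|zE].
  have E (p q : 'I_3) : (p < q)%N ->
      mult (edge_part z q) = mult (edge_part z p).
    move=> pq; have := differential_pair z pq; rewrite dz dffun0E => /esym.
    move/(congr1 (merge (fun=> tt))).
    rewrite merge_comp merge_id ?raddf0 => [|[]//].
    by move/eqP; rewrite subr_eq0 => /eqP.
  by have [->//|] := eqVneq r ord0; rewrite -val_eqE -lt0n => r0; apply: E.
have /in_degreeP d2 := differential_degree z1.
apply/ffunP => s; rewrite dffun0E.
have [/eqP/cards2P[r [q [rq ->]]]|/d2 //] := eqVneq #|s| 2.
wlog {rq} rq : r q / (r < q)%N => [W|].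
  move: rq; rewrite -val_eqE neq_ltn => /orP[/W //|/W].
  by rewrite finset.setUC.
have H : mult (edge_part z q) - mult (edge_part z r) = 0.
  have zqr := etrans (zE q) (esym (zE r)).
  by apply/eqP; rewrite subr_eq0; apply/eqP; exact: zqr.
by rewrite differential_pair // H raddf0.
Qed.

Lemma cocycle0E z : (z \in cocycle 0) =
  (z \in in_degree 0) && [forall r, edge_merge r (vertex_part z) == 0].
Proof.
rewrite [z \in cocycle 0]/(_ && _); case z0: (z \in in_degree 0) => //=.
apply/eqP/forallP => [dz r|zE].
  by rewrite -differential_edge dz edge_partE dffun0E raddf0.
have /in_degreeP d1 := differential_degree z0.
apply/ffunP => s; rewrite dffun0E.
have [/eqP/cards1P[r ->]|/d1 //] := eqVneq #|s| 1%N.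
by rewrite edge_partK differential_edge (eqP (zE r)) raddf0.
Qed.

Lemma eq_in_degree0 b c : b \in in_degree 0 -> c \in in_degree 0 ->
  vertex_part b = vertex_part c -> b = c.
Proof.
move=> /in_degreeP b0 /in_degreeP c0 bc; apply/ffunP => s.
have [/eqP|s0] := eqVneq #|s| 0%N; last by rewrite b0 ?c0.
by rewrite cards_eq0 => /eqP ->; rewrite !vertex_partK bc.
Qed.

Lemma eq_in_degree1 b c : b \in in_degree 1 -> c \in in_degree 1 ->
  edge_part b =1 edge_part c -> b = c.
Proof.
move=> /in_degreeP b1 /in_degreeP c1 bc; apply/ffunP => s.
have [/eqP/cards1P[r ->]|s1] := eqVneq #|s| 1%N; last by rewrite b1 ?c1.
by rewrite !edge_partK bc.
Qed.

Lemma coboundary1P (z : cocycles A P3 1) :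
  reflect (exists t, forall r, edge_part (val z) r = edge_merge r t)
          (z \in coboundary (i := 1)).
Proof.
have /andP[z1 _] := valP z.
apply: (iffP (asboolP _)) => [[b [_ <-]]|[t zt]].
  by exists (vertex_part b) => r; rewrite differential_edge.
exists (cochain0 t); split=> [s|]; first exact: cochain0_degree.
apply: eq_in_degree1 => // [|r]; last first.
  by rewrite differential_edge vertex_part_cochain0 zt.
by apply/differential_degree/in_degreeP => s; exact: cochain0_degree.
Qed.

Lemma coboundary0P (z : cocycles A P3 0) :
  (z \in coboundary (i := 0)) = (z == 0).
Proof.
apply/asboolP/eqP => [[b [b0 db]]|->]; last first.
  by exists 0; rewrite !raddf0; split=> // s _; exact: dffun0E.
apply: val_inj; rewrite -db; have -> : b = 0; last by rewrite raddf0.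
by apply/ffunP => s; rewrite b0 // dffun0E.
Qed.

End TriangleComplex.

(** * The first cohomology group *)

(** The isomorphism is induced by [phi] below, which kills coboundaries by the product rule [sumE].
    Its injectivity is [kaehler_third_edge_image], and the cocycle (0, 0, g dx) maps to g. *)
Lemma triangle_H1 (I J : ideal {poly int}) :
    {subset I <= J} -> (forall f, f \in I -> f^`() \in J) ->
    (forall K : ideal {poly int}, (forall f, f \in I -> f^`() \in K) ->
       {subset J <= K}) ->
  zmod_iso (cohomology (ring_quot I) P3 1) (ring_quot J).
Proof.
move=> IJ dIJ Jmin.
have [D DE] := kaehler_lift IJ dIJ.
have [delta deltaE] := deriv_lift dIJ.
have sumE := sum_kaehler_edges DE deltaE.
pose u (z : cocycles (ring_quot I) P3 1) r := edge_part (val z) r.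
have uE z r : mult (u z r) = mult (u z ord0).
  have zc := valP z; have /andP[z1 _] := zc.
  by move/(cocycle1P z1): zc; apply.
pose phi z : ring_quot J := \sum_r D (u z r) - delta (mult (u z ord0)).
have uB x y r : u (x - y) r = u x r - u y r by exact: edge_partB.
have phiB : zmod_morphism phi.
  move=> x y; rewrite /phi uB [mult _]raddfB [delta _]raddfB /=.
  under eq_bigr do rewrite uB raddfB.
  rewrite sumrB; set a := \sum_i _; set b := \sum_i _.
  by rewrite !opprB addrACA [RHS]addrACA [in RHS](addrC (- _)).
pose phi' : {additive _ -> _} := HB.pack phi
  (GRing.isZmodMorphism.Build _ _ phi phiB).
apply: (@quot_iso _ _ _ phi') => [y|z].
  have [g ->] := classP y.
  pose w : tensor_power (ring_quot I) bool :=
    kdiff (rq_class I g) (rq_class I 'X).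
  have w0 : mult w = 0 by exact: mult_kdiff.
  have [z z1 zE] : exists2 z : cochain (ring_quot I) P3, z \in in_degree 1 &
      forall r, edge_part z r = if r == opposite ord0 then w else 0.
    exists (cochain1 (fun r => if r == opposite ord0 then w else 0)).
      exact: cochain1_degree.
    by move=> r; exact: edge_part_cochain1.
  have zm r : mult (edge_part z r) = 0.
    by rewrite zE; case: ifP => _; rewrite ?w0 ?raddf0.
  have zc : z \in cocycle 1.
    by apply/(cocycle1P z1) => r; rewrite !zm.
  exists (exist _ z zc); rewrite -[LHS]/(phi _) /phi /u /= zm raddf0 subr0.
  rewrite (bigD1 (opposite ord0)) //= big1 => [|r /negPf r0]; last first.
    by rewrite zE r0 raddf0.
  by rewrite addr0 zE eqxx; exact: kaehler_kdiffX.
apply/eqP/coboundary1P => [phiz|[t zt]]; last first.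
  rewrite -[LHS]/(phi z) /phi; under eq_bigr do rewrite /u zt.
  by rewrite sumE /u zt mult_edge_merge subrr.
(* Subtracting the coboundary of [t] leaves only [w] on the third edge. As [phi] vanishes at [z] and
   on coboundaries, [D w = 0]. *)
have [t [t0 t1 t2]] := edge_merge_lift2 (uE z).
pose w := u z (opposite ord0) - edge_merge (opposite ord0) t.
have E r : u z r = edge_merge r t + (if r == opposite ord0 then w else 0).
  have [->|->|->] := triangle_cases ord0 r.
  - by rewrite opposite_neq addr0.
  - by rewrite ordS_neq_opposite addr0.
  - by rewrite eqxx /w addrC subrK.
have Dw : D w = 0.
  move: phiz; rewrite -[LHS]/(phi z) /phi t0 mult_edge_merge.
  under eq_bigr do rewrite E raddfD.
  rewrite big_split /= sumE [_ + \sum_i _]addrC addrK => <-.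
  rewrite (bigD1 (opposite ord0)) // eqxx big1 => [|r /negPf ->].
    by rewrite /= addr0.
  by rewrite raddf0.
have [t' [t'0 t'1 t'2]] := kaehler_third_edge_image DE Jmin t2 Dw.
exists (t + t') => r; rewrite raddfD -/(u z r) E /=; congr (_ + _).
have [->|->|->] := triangle_cases ord0 r.
- by rewrite opposite_neq t'0.
- by rewrite ordS_neq_opposite t'1.
- by rewrite eqxx t'2.
Qed.

Lemma deriv_mulX_sub (f : {poly int}) : f = ('X * f)^`() - 'X * f^`().
Proof. by rewrite derivM derivX mul1r addrK. Qed.

Lemma sub_deriv_ideal (I : ideal {poly int}) : {subset I <= deriv_ideal I}.
Proof.
move=> f fI; have dI g : g \in I -> g^`() \in deriv_ideal I.
  by move=> gI; apply: ideal_genS; exists g.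
by rewrite [f]deriv_mulX_sub rpredB // ?mul_absorbing ?dI // mul_absorbing.
Qed.

Lemma triangle_H1_deriv_ideal (I : ideal {poly int}) :
  zmod_iso (cohomology (ring_quot I) P3 1) (ring_quot (deriv_ideal I)).
Proof.
apply: triangle_H1 => [|f fI|K IK f /ideal_genP fI].
- exact: sub_deriv_ideal.
- by apply: ideal_genS; exists f.
- by apply: fI => _ [g gI <-]; exact: IK.
Qed.

Section DerivStable.
Variable J : ideal {poly int}.

(** An ideal by the product rule, so membership of a whole generated ideal can be tested on
    generators. *)
Definition deriv_stable : {pred {poly int}} :=
  fun f => (f \in J) && (f^`() \in J).

Lemma deriv_stableE f :
  (f \in deriv_stable) = (f \in J) && (f^`() \in J).
Proof. by []. Qed.

Fact deriv_stable_closed : zmod_closed deriv_stable.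
Proof.
split=> [|f g]; rewrite !deriv_stableE; first by rewrite linear0 !rpred0.
by move=> /andP[fJ dfJ] /andP[gJ dgJ]; rewrite derivB !rpredB.
Qed.
HB.instance Definition _ :=
  GRing.isZmodClosed.Build {poly int} deriv_stable deriv_stable_closed.

Fact deriv_stable_absorbing a :
  {in deriv_stable, forall f, a * f \in deriv_stable}.
Proof.
move=> f; rewrite !deriv_stableE => /andP[fJ dfJ].
by rewrite derivM rpredD ?mul_absorbing.
Qed.
HB.instance Definition _ :=
  isMulAbsorbing.Build {poly int} deriv_stable deriv_stable_absorbing.

End DerivStable.

Lemma poly_deriv_ideal (p : {poly int}) :
  let I : ideal {poly int} := ideal_gen [set p] in
  let J : ideal {poly int} := ideal_gen [set p; p^`()] in
  [/\ {subset I <= J}, forall f, f \in I -> f^`() \in J &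
      forall K : ideal {poly int}, (forall f, f \in I -> f^`() \in K) ->
        {subset J <= K}].
Proof.
move=> I J.
have sub f : f \in I -> f \in deriv_stable J.
  move/ideal_genP; apply => _ ->; rewrite deriv_stableE.
  by apply/andP; split; apply: ideal_genS; [left | right].
split=> [f /sub/andP[]|f /sub/andP[]|K dK f /ideal_genP] //; apply.
have pI : p \in I by exact: ideal_genS.
move=> _ [->|->]; last exact: dK.
rewrite [X in X \in _]deriv_mulX_sub rpredB ?mul_absorbing ?dK //.
exact: mul_absorbing.
Qed.

Lemma triangle_H1_poly (p : {poly int}) :
  zmod_iso (cohomology (poly_algebra p) P3 1)
           (ring_quot (ideal_gen [set p; p^`()])).
Proof. by have [IJ dIJ Jmin] := poly_deriv_ideal p; exact: triangle_H1. Qed.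

(** * Ranks and lattices *)

Section RankCriterion.
Variable M : zmodType.

Lemma tens_is_zmod_morphism (x : M) : zmod_morphism (tens x).
Proof. by move=> q s; apply/eqP; rewrite eq_sym subr_eq -tensDr subrK. Qed.
HB.instance Definition _ x :=
  GRing.isZmodMorphism.Build rat (tensQ M) (tens x) (tens_is_zmod_morphism x).

Definition tensl (q : rat) (x : M) := tens x q.

Lemma tensl_is_zmod_morphism q : zmod_morphism (tensl q).
Proof.
by move=> x y; apply/eqP; rewrite /tensl eq_sym subr_eq -tensDl subrK.
Qed.
HB.instance Definition _ q :=
  GRing.isZmodMorphism.Build M (tensQ M) (tensl q) (tensl_is_zmod_morphism q).

Lemma tensBl (x y : M) q : tens (x - y) q = tens x q - tens y q.
Proof. exact: (raddfB (tensl q)). Qed.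

Lemma tens0l q : tens (0 : M) q = 0.
Proof. exact: (raddf0 (tensl q)). Qed.

Lemma tensMz (x : M) q (k : int) : tens (x *~ k) q = tens x (k%:~R * q).
Proof.
have -> : tens (x *~ k) q = tens x q *~ k by exact: (raddfMz (tensl q)).
by rewrite mulrzl raddfMz.
Qed.

(** Finitely many rational coefficients have a common denominator. *)
Lemma tensQP (u : tensQ M) : exists x (k : int), k != 0 /\ u = tens x k%:~R^-1.
Proof.
elim/present_ind: u => [|u v [x [k [k0 ->]]] [y [l [l0 ->]]]|[x q]].
- by exists 0, 1; rewrite tens0l.
- exists (x *~ l - y *~ k), (k * l); split; first by rewrite mulf_neq0.
  rewrite tensBl !tensMz intrM.
  have k'0 : k%:~R != 0 :> rat by rewrite intr_eq0.
  have l'0 : l%:~R != 0 :> rat by rewrite intr_eq0.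
  by congr (tens _ _ - tens _ _); field; rewrite k'0 l'0.
exists (x *~ numq q), (denq q); split; first exact: denq_neq0.
by rewrite tensMz divq_num_den.
Qed.

(** A map with torsion kernel whose image lies in [X] and meets every line of [X] becomes an
    isomorphism onto [X] after tensoring with Q. *)
Lemma has_rank_span (N : zmodType) (V : vectType rat) (X : {vspace V})
    (phi : {additive N -> V}) :
    zmod_iso M N -> (forall x, phi x \in X) ->
    (forall x, phi x = 0 -> exists2 k : int, k != 0 & x *~ k = 0) ->
    (forall v, v \in X -> exists2 k : int, k != 0 & exists x, phi x = v *~ k) ->
  has_rank M (\dim X).
Proof.
move=> [h h_bij] phiX phi_ker phi_span.
pose g (xq : M * rat) := xq.2 *: phi (h xq.1).
have gS r : @tensQ_rel M r -> fglin g r = 0.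
  case=> -[x [y [q ->]]]; rewrite raddfB raddfD /= !fglinE /g /=.
    by rewrite (raddfD h) (raddfD phi) scalerDr subrr.
  by rewrite scalerDl subrr.
pose G : tensQ M -> V := plift g.
have GB : zmod_morphism G by exact: plift_is_zmod_morphism.
have GE x q : G (tens x q) = q *: phi (h x) by exact: (plift_gen gS).
have GZ a u : G (a *: u) = a *: G u.
  have [x [k [_ ->]]] := tensQP u.
  by rewrite -[a *: _]/(tensQ_scale a _) tensQ_scale_tens !GE scalerA.
pose F (u : tensQ M) : 'rV[rat]_(\dim X) := \row_i coord (vbasis X) i (G u).
have FB : zmod_morphism F.
  by move=> u v; apply/rowP => i; rewrite !mxE GB linearB.
have FZ : scalable F by move=> a u; apply/rowP => i; rewrite !mxE GZ linearZ.
pose F' : {linear tensQ M -> 'rV[rat]_(\dim X)} := HB.pack F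
  (GRing.isZmodMorphism.Build _ _ F FB) (GRing.isScalable.Build _ _ _ _ F FZ).
have GX u : G u \in X by have [x [k [_ ->]]] := tensQP u; rewrite GE memvZ.
exists F'; apply: inj_surj_bijective => [|y].
  apply: additive_inj => u /rowP Fu.
  have : G u = 0.
    rewrite (coord_vbasis (GX u)) big1 // => i _.
    by have := Fu i; rewrite !mxE => ->; rewrite scale0r.
  have [x [k [k0 ->]]] := tensQP u; rewrite GE => /eqP.
  rewrite scaler_eq0 invr_eq0 intr_eq0 (negPf k0) => /eqP/phi_ker[l l0].
  rewrite -raddfMz => hx.
  have x0 : x *~ l = 0 by apply: (bij_inj h_bij); rewrite hx raddf0.
  have l'0 : l%:~R != 0 :> rat by rewrite intr_eq0.
  by rewrite -[_^-1](mulVKf l'0) -tensMz x0 tens0l.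
pose v := \sum_i y 0 i *: (vbasis X)`_i.
have vX : v \in X.
  rewrite rpred_sum // => i _.
  by rewrite memvZ // vbasis_mem ?mem_nth ?size_tuple.
have [k k0 [x phix]] := phi_span v vX; have [h' _ hK] := h_bij.
exists (tens (h' x) k%:~R^-1); apply/rowP => i.
rewrite !mxE GE hK phix -scaler_int scalerA mulVf ?intr_eq0 // scale1r.
by rewrite coord_sum_free // (basis_free (vbasisP X)).
Qed.

End RankCriterion.

Lemma rat_row_scale n (v : 'rV[rat]_n) :
  exists2 k : int, k != 0 & exists c : 'rV[int]_n, v *~ k = map_mx intr c.
Proof.
exists (\prod_i denq (v 0 i)).
  by apply/prodf_neq0 => i _; exact: denq_neq0.
exists (\row_i (numq (v 0 i) * \prod_(j | j != i) denq (v 0 j))).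
apply/rowP => i; rewrite -scaler_int !mxE (bigD1 i) //= !intrM mulrC mulrA.
by congr (_ * _); rewrite -{1}[v 0 i]divq_num_den mulfVK // intr_eq0 denq_neq0.
Qed.

(** [M] is the group of integer points of [X]. Take an integer matrix [B] whose rows span [X] and
    its Smith form L Dm R. Then [X] is spanned by the first r rows of the unimodular [R], and these
    rows form a Z-basis of its integer points. *)
Lemma lattice_iso (M : zmodType) n (X : {vspace 'rV[rat]_n})
    (phi : {additive M -> 'rV[rat]_n}) :
    injective phi -> (forall x, phi x \in X) ->
    (forall x, exists c : 'rV[int]_n, phi x = map_mx intr c) ->
    (forall c : 'rV[int]_n, map_mx intr c \in X ->
       exists x, phi x = map_mx intr c) ->
  zmod_iso M 'rV[int]_(\dim X).
Proof.
move=> phi_inj phiX phiZ phi_surj; set r := \dim X; pose e := vbasis X.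
have rn : (r <= n)%N.
  by have := dimvS (subvf X); rewrite dimvf dim_matrix mul1r.
have [B BE] : exists B : 'M[int]_(r, n), forall i,
    exists2 k : int, k != 0 & map_mx intr (row i B) = e`_i *~ k.
  have /choice[b bE] i : exists c : 'rV[int]_n,
      exists2 k : int, k != 0 & map_mx intr c = (e`_(i : 'I_r)) *~ k.
    by have [k k0 [c cE]] := rat_row_scale e`_i; exists c, k.
  by exists (\matrix_i b i) => i; rewrite rowK.
have /choice[k kP] i : exists k : int,
    k != 0 /\ map_mx intr (row i B) = e`_i *~ k.
  by have [k k0 kE] := BE i; exists k.
have {BE} k0 i : (k i)%:~R != 0 :> rat by rewrite intr_eq0; case: (kP i).
have BE i : row i (map_mx intr B) = (k i)%:~R *: e`_i :> 'rV[rat]_n.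
  by rewrite -map_row scaler_int; case: (kP i).
have BX (a : 'rV[rat]_r) : a *m map_mx intr B \in X.
  rewrite mulmx_sum_row rpred_sum // => i _; rewrite memvZ // BE memvZ //.
  by rewrite vbasis_mem ?mem_nth ?size_tuple.
have XB v : v \in X -> exists a : 'rV[rat]_r, v = a *m map_mx intr B.
  move=> vX; exists (\row_i (coord e i v / (k i)%:~R)).
  rewrite mulmx_sum_row {1}(coord_vbasis vX); apply: eq_bigr => i _.
  by rewrite mxE BE scalerA divfK.
have B_free (a : 'rV[rat]_r) : a *m map_mx intr B = 0 -> a = 0.
  rewrite mulmx_sum_row => aB; apply/rowP => i; rewrite mxE.
  have /freeP/(_ (fun i => a 0 i * (k i)%:~R)) := basis_free (vbasisP X).
  have -> : \sum_(i < r) (a 0 i * (k i)%:~R) *: (vbasis X)`_i = 0.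
    by rewrite -[RHS]aB; apply: eq_bigr => j _; rewrite BE scalerA.
  by move=> /(_ erefl i)/eqP; rewrite mulf_eq0 (negPf (k0 i)) orbF => /eqP.
have [L Lu [R Ru [d _ Bdef]]] := int_Smith_normal_form B.
set Dm := \matrix_(i, j) _ in Bdef.
have BQ : map_mx intr B = map_mx intr L *m map_mx intr Dm *m map_mx intr R
    :> 'M[rat]_(r, n) by rewrite -!map_mxM -Bdef.
(* A zero invariant factor would give a zero row of L^-1 B, hence of L^-1, as the rows of [B] are
   independent. *)
have d0 (i : 'I_r) : d`_i != 0.
  apply/eqP => di; have aB : row i (invmx L) *m B = 0.
    rewrite -row_mul Bdef -mulmxA mulKmx // row_mul.
    have -> : row i Dm = 0 by apply/rowP => j; rewrite !mxE di mul0rn.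
    by rewrite mul0mx.
  have aE : row i (invmx L) = 0.
    have /B_free/rowP aQ : map_mx intr (row i (invmx L)) *m map_mx intr B = 0
      :> 'rV[rat]_n by rewrite -map_mxM aB map_mx0.
    by apply/rowP => j; have /eqP := aQ j; rewrite !mxE intr_eq0 => /eqP.
  have := congr1 (row i) (mulVmx Lu); rewrite row_mul aE mul0mx.
  by move/rowP/(_ i)/eqP; rewrite !mxE eqxx.
pose pad (w : 'rV[int]_r) : 'rV[int]_n :=
  \row_j \sum_i w 0 i *+ (i == j :> nat).
have padX w : map_mx intr (pad w *m R) \in X.
  pose a : 'rV[rat]_r := \row_i ((w 0 i)%:~R / (d`_i)%:~R).
  suff -> : map_mx intr (pad w *m R)
      = a *m invmx (map_mx intr L) *m map_mx intr B by exact: BX.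
  have LuQ : (map_mx intr L : 'M[rat]_r) \in unitmx.
    by rewrite unitmxE det_map_mx rmorph_unit.
  rewrite BQ -!mulmxA mulKmx // mulmxA map_mxM; congr (_ *m _).
  apply/rowP => j; rewrite !mxE rmorph_sum; apply: eq_bigr => i _.
  by rewrite !mxE !rmorphMn /= mulrnAr divfK // intr_eq0.
(* The first r coordinates with respect to the rows of [R]; the others vanish on [X] because the
   columns of [Dm] from r on are zero. *)
pose f x : 'rV[int]_r :=
  \row_i (map_mx numq (phi x) *m invmx R) 0 (widen_ord rn i).
have numK (c : 'rV[int]_n) : map_mx numq (map_mx intr c : 'rV[rat]_n) = c.
  by apply/rowP => j; rewrite !mxE numq_int.
have fE x c : phi x = map_mx intr c ->
    f x = \row_i (c *m invmx R) 0 (widen_ord rn i).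
  by move=> xc; rewrite /f xc numK.
have fB : zmod_morphism f.
  move=> x y; have [[c xc] [c' yc]] := (phiZ x, phiZ y).
  rewrite (fE _ _ xc) (fE _ _ yc).
  rewrite (fE _ (c - c')) ?raddfB /= ?xc ?yc ?map_mxB //.
  by apply/rowP => i; rewrite mulmxBl !mxE.
pose f' : {additive _ -> _} := HB.pack f (GRing.isZmodMorphism.Build _ _ f fB).
exists f'; apply: inj_surj_bijective => [|w].
  apply: additive_inj => x fx; have [c xc] := phiZ x.
  have [a aE] := XB _ (phiX x).
  have cR0 : c *m invmx R = 0.
    apply/rowP => j; have [jr|rj] := ltnP j r.
      have /rowP/(_ (Ordinal jr)) : f x = 0 by exact: fx.
      rewrite (fE _ _ xc) !mxE => {2}<-.
      by apply: eq_bigr => l _; congr (_ * invmx R _ _); apply: val_inj.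
    rewrite [RHS]mxE; apply/eqP; rewrite -(intr_eq0 rat).
    have /rowP/(_ j) : map_mx intr (c *m invmx R)
        = a *m map_mx intr L *m map_mx intr Dm.
      rewrite map_mxM -xc aE BQ !mulmxA -[X in X = _]mulmxA -map_mxM mulmxV //.
      by rewrite map_mx1 mulmx1.
    rewrite [LHS]mxE => ->; rewrite mxE big1 // => i _.
    by rewrite !mxE ltn_eqF ?(leq_trans _ rj) // mulr0n mulr0.
  apply: phi_inj; rewrite raddf0 xc.
  by rewrite -[c](mulmxKV Ru) cR0 mul0mx map_mx0.
have [x xE] := phi_surj _ (padX w); exists x.
rewrite -[LHS]/(f x) (fE _ _ xE) mulmxK //; apply/rowP => i.
rewrite !mxE (bigD1 i) //= eqxx big1 ?addr0 // => j /negPf ji.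
by rewrite [_ == _]ji.
Qed.

(** * Rational bases *)

(* [phi] identifies [U (x) Q] with [rat^n], the [b i] giving the basis; the   *)
(* multiplier needed to bring an element into the span of the [b i] can be    *)
(* taken in [D]: for [D = pred1 1] the [b i] form a basis of [U] over Z.      *)
Definition rat_basis (D : {pred int}) (U : zmodType) n
    (phi : {additive U -> 'rV[rat]_n}) (b : 'I_n -> U) : Prop :=
  (forall i, phi (b i) = delta_mx 0 i) /\
  (forall u, exists2 k, k \in D & exists c : 'I_n -> int,
     u *~ k = \sum_i b i *~ c i).

Lemma lmodQ_mulrz_eq0 (W : lmodType rat) (w : W) (k : int) :
  k != 0 -> w *~ k = 0 -> w = 0.
Proof.
move=> k0 /eqP; rewrite -scaler_int scaler_eq0 intr_eq0 (negPf k0).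
by move/eqP.
Qed.

Section RatBasis.
Variables (D : {pred int}) (D0 : 0 \notin D) (D1 : 1 \in D).
Hypothesis DM : {in D &, forall k l, k * l \in D}.

Lemma multiplier_neq0 k : k \in D -> k != 0.
Proof. by move=> kD; apply: contraNneq D0 => <-. Qed.

Section Theory.
Variables (U : zmodType) (n : nat).
Variables (phi : {additive U -> 'rV[rat]_n}) (b : 'I_n -> U).
Hypothesis phi_basis : rat_basis D phi b.

Lemma rat_basis_sum (c : 'I_n -> int) :
  phi (\sum_i b i *~ c i) = map_mx intr (\row_i c i).
Proof.
rewrite raddf_sum [RHS]row_sum_delta; apply: eq_bigr => i _.
by rewrite raddfMz phi_basis.1 -scaler_int !mxE.
Qed.

Lemma rat_basis_ker u : phi u = 0 -> exists2 k, k \in D & u *~ k = 0.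
Proof.
have [k kD [c uc]] := phi_basis.2 u; move=> phiu; exists k => //.
rewrite uc big1 // => i _.
have /rowP/(_ i)/eqP : map_mx intr (\row_i c i) = 0 :> 'rV[rat]_n.
  by rewrite -rat_basis_sum -uc raddfMz phiu mul0rz.
by rewrite !mxE intr_eq0 => /eqP ->; rewrite mulr0z.
Qed.

Lemma rat_basis_ker_comp (W : zmodType) (h : {additive W -> U}) w :
  phi (h w) = 0 -> exists2 k, k \in D & h (w *~ k) = 0.
Proof.
by move=> /rat_basis_ker[k kD hk]; exists k => //; rewrite raddfMz.
Qed.

Lemma rat_basis_span v :
  exists2 k : int, k != 0 & exists u, phi u = v *~ k.
Proof.
have [k k0 [c vc]] := rat_row_scale v; exists k => //.
exists (\sum_i b i *~ c 0 i); rewrite rat_basis_sum vc; congr map_mx.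
by apply/rowP => i; rewrite mxE.
Qed.

(** The linear map is prescribed on the basis; multipliers in [D] are nonzero, hence cancel in a
    rational space. *)
Lemma rat_basis_lift (W : vectType rat) (g : {additive U -> W}) :
  exists F : 'Hom('rV[rat]_n, W), forall u, F (phi u) = g u.
Proof.
pose F (v : 'rV[rat]_n) : W := \sum_i v 0 i *: g (b i).
have FB : zmod_morphism F.
  move=> u v; rewrite /F -sumrB; apply: eq_bigr => i _.
  by rewrite !mxE scalerBl.
have FZ : scalable F.
  move=> a u; rewrite /F scaler_sumr; apply: eq_bigr => i _.
  by rewrite mxE scalerA.
pose F' : {linear 'rV[rat]_n -> W} := HB.pack F
  (GRing.isZmodMorphism.Build _ _ F FB) (GRing.isScalable.Build _ _ _ _ F FZ).
exists (linfun F') => u; rewrite lfunE.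
have [k kD [c uc]] := phi_basis.2 u.
apply/eqP; rewrite -subr_eq0; apply/eqP.
apply: (lmodQ_mulrz_eq0 (multiplier_neq0 kD)).
rewrite mulrzBl -!raddfMz /= uc rat_basis_sum raddf_sum.
apply/eqP; rewrite subr_eq0; apply/eqP; apply: eq_bigr => i _.
by rewrite !mxE raddfMz scaler_int.
Qed.

Lemma rat_basis_ext (W : vectType rat) (F G : {additive 'rV[rat]_n -> W}) :
  (forall u, F (phi u) = G (phi u)) -> F =1 G.
Proof.
move=> FG v; have [k k0 [u uv]] := rat_basis_span v.
apply/eqP; rewrite -subr_eq0; apply/eqP/(lmodQ_mulrz_eq0 k0).
by rewrite mulrzBl -!raddfMz /= -uv FG subrr.
Qed.

End Theory.

Lemma rat_basis_tensor (A : zmodType) n (phi : {additive A -> 'rV[rat]_n}) b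
    (K : finType) : rat_basis D phi b ->
  exists (phiK : {additive tensor_power A K -> 'rV[rat]_(n ^ #|K|)}) bK,
    rat_basis D phiK bK.
Proof.
move=> [phib span].
have -> : (n ^ #|K|)%N = #|{: {ffun K -> 'I_n}}| by rewrite card_ffun card_ord.
set N := #|_|.
(* Coordinates are indexed by the functions from K to the basis indices: each is the product over K
   of one coordinate of each factor. *)
pose g (f : {ffun K -> A}) : 'rV[rat]_N :=
  \row_(j < N) \prod_k phi (f k) 0 (enum_val j k).
have [|phiK phiKE] := @tensor_lift A K _ g.
  move=> f k x y; apply/rowP => j; rewrite !mxE.
  rewrite (bigD1 k) //= [X in _ = X + _](bigD1 k) //=.
  rewrite [X in _ = _ + X](bigD1 k) //= !ffunE !eqxx raddfD mxE mulrDl.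
  by congr (_ * _ + _ * _); apply: eq_bigr => i /negPf ik; rewrite !ffunE ik.
pose bK (j : 'I_N) : tensor_power A K := pure [ffun k => b (enum_val j k)].
exists phiK, bK; split=> [j|].
  rewrite phiKE; apply/rowP => l; rewrite !mxE eqxx /=.
  under eq_bigr do rewrite ffunE phib mxE eqxx /=.
  have [->|jl] := eqVneq l j; first by rewrite big1 // => k _; rewrite eqxx.
  have [k kjl] : exists k, enum_val l k != enum_val j k.
    apply/existsP; apply: contraR jl => /existsPn jl.
    apply/eqP/enum_val_inj/ffunP => k; apply/eqP; have := jl k.
    by rewrite negbK.
  by rewrite (bigD1 k) //= (negPf kjl) mul0r.
pose spanned t := exists2 k, k \in D & exists c : 'I_N -> int,
  t *~ k = \sum_i bK i *~ c i.
have spanned0 : spanned 0.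
  by exists 1 => //; exists (fun=> 0); rewrite mul0rz big1.
have spannedB s t : spanned s -> spanned t -> spanned (s - t).
  move=> [k kD [c sc]] [l lD [d td]]; exists (k * l); first exact: DM.
  exists (fun i => c i * l - d i * k).
  rewrite mulrzBl mulrzA sc [k * l]mulrC mulrzA td !mulrz_suml -sumrB.
  by apply: eq_bigr => i _; rewrite mulrzBr !mulrzA.
have spannedM t (k : int) : spanned t -> spanned (t *~ k).
  move=> [l lD [c tc]]; exists l => //; exists (fun i => c i * k).
  rewrite -mulrzA mulrC mulrzA tc mulrz_suml.
  by apply: eq_bigr => i _; rewrite mulrzA.
have spannedV t k : k \in D -> spanned (t *~ k) -> spanned t.
  move=> kD [l lD [c tc]]; exists (k * l); first exact: DM.
  by exists c; rewrite mulrzA.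
have spanned_sum m (t : 'I_m -> tensor_power A K) :
    (forall i, spanned (t i)) -> spanned (\sum_i t i).
  move=> st; elim/big_ind: _ => // x y sx sy.
  rewrite -[y]opprK; apply: (spannedB) => //.
  by rewrite -sub0r; apply: spannedB.
suff spanned_pure (f : {ffun K -> A}) : spanned (pure f).
  by apply: tensor_ind.
(* Replace the entries of [f] by elements of [b], one position at a time.     *)
suff: forall (S : {set K}) (f : {ffun K -> A}),
    (forall k, k \notin S -> exists i, f k = b i) -> spanned (pure f).
  by move=> /(_ [set: K]%SET f); apply=> k; rewrite finset.inE.
move=> S; move En: #|S| => m; elim: m => [|m IHm] in S En *.
  move=> h hb; have S0 := cards0_eq En.
  have /fin_all_exists[i hi] k : exists i, h k = b i.
    by apply: hb; rewrite S0 finset.inE.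
  exists 1 => //; exists (fun j => (j == enum_rank [ffun k => i k] :> 'I_N)%:Z).
  rewrite mulr1z (bigD1 (enum_rank [ffun k => i k])) //= eqxx mulr1z.
  rewrite big1 ?addr0 => [|j /negPf ->]; last by rewrite mulr0z.
  by congr pure; apply/ffunP => k; rewrite !ffunE enum_rankK ffunE.
move=> h hb; have /set0Pn[k kS] : S != finset.set0.
  by rewrite -card_gt0 En.
have [l lD [c hc]] := span (h k).
pose at_k : {additive A -> tensor_power A K} := HB.pack
  (fun x => pure (fset_at h k x))
  (GRing.isZmodMorphism.Build _ _ _ (pure_at_is_zmod_morphism h k)).
apply: (spannedV _ l lD); rewrite -(fset_at_id h k) -[pure _]/(at_k (h k)).
rewrite -raddfMz hc raddf_sum; apply: spanned_sum => i.
rewrite raddfMz; apply: spannedM.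
apply: (IHm (S :\ k)%SET).
  by move: En; rewrite (cardsD1 k) kS => -[].
move=> j; rewrite !finset.inE negb_and negbK ffunE.
by case: eqP => [_ _|_ /= /hb //]; exists i.
Qed.

End RatBasis.

(** * Rational bases of quotients of Z[x] *)

Section QuotientBasis.
Variable J : ideal {poly int}.
Local Notation pZtoQ := (map_poly (intr : int -> rat)).

Lemma pZtoQ_inj : injective pZtoQ.
Proof. by apply: map_inj_poly => //; exact: intr_inj. Qed.

Lemma rat_poly_int (q : {poly rat}) :
  exists2 k : int, k != 0 & exists c : {poly int}, q *~ k = pZtoQ c.
Proof.
have [c [k k0 ->]] := rat_poly_scale q; exists k => //; exists c.
by rewrite -scaler_int scalerA divff ?scale1r // intr_eq0.
Qed.

(** The coordinates are those of the remainder modulo [g] in Q[x], and the basis consists of the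
    powers of X below the degree of [g]. *)
Lemma rat_basis_quot (D : {pred int}) (g : {poly rat}) : g != 0 ->
    (forall f, f \in J -> g %| pZtoQ f) ->
    (forall f, exists2 k, k \in D & exists c : {poly int},
       (size c <= (size g).-1)%N /\ f *~ k - c \in J) ->
  exists (phi : {additive ring_quot J -> 'rV[rat]_(size g).-1}) b,
    rat_basis D phi b.
Proof.
move=> g0 Jg divJ; set r := (size g).-1.
have gr : size g = r.+1 by rewrite prednK // size_poly_gt0.
pose phi (x : ring_quot J) : 'rV[rat]_r := poly_rV (pZtoQ (repr x) %% g).
have phiE f : phi (rq_class J f) = poly_rV (pZtoQ f %% g).
  congr poly_rV; apply/eqP; rewrite -subr_eq0 -modpN -modpD -raddfB.
  apply/eqP/modp_eq0P/Jg; rewrite -rq_class_eq; apply/eqP; exact: rq_classK.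
have phiB : zmod_morphism phi.
  move=> x y; rewrite -[x]rq_classK -[y]rq_classK -rq_classB !phiE.
  by rewrite raddfB modpD modpN raddfB.
pose phi' : {additive ring_quot J -> 'rV[rat]_r} := HB.pack phi
  (GRing.isZmodMorphism.Build _ _ phi phiB).
exists phi', (fun i => rq_class J 'X^i); split=> [i|x].
  rewrite -[LHS]/(phi _) phiE map_polyXn modp_small ?size_polyXn ?gr ?ltnS //.
  by apply/rowP => j; rewrite !mxE coefXn eqxx.
have [k kD [c [cr fc]]] := divJ (repr x); exists k => //.
exists (fun i => c`_i).
have -> : x *~ k = rq_class J c.
  have : rq_class J (repr x *~ k) = rq_class J c.
    by apply/eqP; rewrite rq_class_eq.
  by rewrite raddfMz /= rq_classK.
have cE : c = \sum_(i < r) 'X^i *~ c`_i.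
  transitivity (\poly_(i < r) c`_i).
    apply/polyP => i; rewrite coef_poly; case: ltnP => // ri.
    by rewrite nth_default // (leq_trans cr).
  by rewrite poly_def; apply: eq_bigr => i _; rewrite -scaler_int intz.
by rewrite {1}cE raddf_sum; apply: eq_bigr => i _; rewrite raddfMz.
Qed.

Lemma quot_division (g : {poly rat}) : g != 0 ->
    (forall f, g %| pZtoQ f -> exists2 k : int, k != 0 & f *~ k \in J) ->
  forall f, exists2 k : int, k != 0 & exists c : {poly int},
    (size c <= (size g).-1)%N /\ f *~ k - c \in J.
Proof.
move=> g0 gJ f; have [k k0 [c cE]] := rat_poly_int (pZtoQ f %% g).
have : g %| pZtoQ (f *~ k - c).
  rewrite raddfB raddfMz /= -cE -mulrzBl {1}(divp_eq (pZtoQ f) g) addrK.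
  by rewrite -scaler_int dvdpZr ?intr_eq0 // dvdp_mull.
move=> /gJ[l l0 fcJ]; exists (k * l); first by rewrite mulf_neq0.
exists (c *~ l); split; last by rewrite mulrzA -mulrzBl.
have cs : (size c <= (size g).-1)%N.
  rewrite -size_rat_int_poly.
  by rewrite -cE -scaler_int size_scale ?intr_eq0 // -ltnS prednK
    ?size_poly_gt0 // ltn_modp.
by rewrite -scaler_int (leq_trans (size_scale_leq _ _)).
Qed.

End QuotientBasis.

Section DvdRat.
Variable g : {poly rat}.

Definition dvd_rat : {pred {poly int}} := fun f => g %| map_poly intr f.

Lemma dvd_ratE f : (f \in dvd_rat) = (g %| map_poly intr f).
Proof. by []. Qed.

Fact dvd_rat_closed : zmod_closed dvd_rat.
Proof.
split=> [|f h]; rewrite !dvd_ratE ?raddf0 ?dvdp0 //.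
by move=> gf gh; rewrite raddfB dvdp_sub.
Qed.
HB.instance Definition _ :=
  GRing.isZmodClosed.Build {poly int} dvd_rat dvd_rat_closed.

Fact dvd_rat_absorbing a : {in dvd_rat, forall f, a * f \in dvd_rat}.
Proof. by move=> f; rewrite !dvd_ratE rmorphM /= => gf; rewrite dvdp_mull. Qed.
HB.instance Definition _ :=
  isMulAbsorbing.Build {poly int} dvd_rat dvd_rat_absorbing.

End DvdRat.

Section Principal.
Variable p : {poly int}.
Hypothesis p0 : p != 0.
Local Notation pZtoQ := (map_poly (intr : int -> rat)).
Local Notation I := (ideal_gen [set p] : ideal {poly int}).
Local Notation J := (ideal_gen [set p; p^`()] : ideal {poly int}).
Local Notation m := (size p).-1.

Lemma pZtoQ_neq0 : pZtoQ p != 0.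
Proof. by rewrite -(raddf0 pZtoQ) (inj_eq pZtoQ_inj). Qed.

Lemma rat_basis_poly_algebra :
  exists (phi : {additive poly_algebra p -> 'rV[rat]_m}) b,
    rat_basis [pred k | k != 0] phi b.
Proof.
have -> : m = (size (pZtoQ p)).-1 by rewrite size_rat_int_poly.
apply: rat_basis_quot => [|f /ideal_genP fI|].
- exact: pZtoQ_neq0.
- by rewrite -dvd_ratE; apply: fI => _ ->; rewrite dvd_ratE.
apply: quot_division => [|f /dvdpP[q fq]]; first exact: pZtoQ_neq0.
have [k k0 [c qc]] := rat_poly_int q; exists k => //.
suff -> : f *~ k = c * p by rewrite mul_absorbing // ideal_genS.
by apply: pZtoQ_inj; rewrite rmorphMz rmorphM /= fq -qc mulrzAl.
Qed.

Lemma rat_basis_poly_algebra_unit : lead_coef p \is a GRing.unit ->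
  exists (phi : {additive poly_algebra p -> 'rV[rat]_m}) b,
    rat_basis (pred1 1) phi b.
Proof.
move=> pu; have -> : m = (size (pZtoQ p)).-1 by rewrite size_rat_int_poly.
apply: rat_basis_quot => [|f /ideal_genP fI|f].
- exact: pZtoQ_neq0.
- by rewrite -dvd_ratE; apply: fI => _ ->; rewrite dvd_ratE.
exists 1; first by rewrite inE.
exists (f %% p); split.
  by rewrite size_rat_int_poly -ltnS prednK ?size_poly_gt0 // ltn_modp.
rewrite mulr1z {1}(Pdiv.IdomainUnit.divp_eq pu f) addrK.
by rewrite mul_absorbing // ideal_genS.
Qed.

Lemma rat_basis_deriv_quot :
  exists (phi : {additive ring_quot J -> 'rV[rat]_(gcd_deriv_degree p)}) b,
    rat_basis [pred k | k != 0] phi b.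
Proof.
rewrite /gcd_deriv_degree; set g := gcdp _ _.
have g0 : g != 0 by rewrite gcdp_eq0 negb_and pZtoQ_neq0.
apply: rat_basis_quot => // [f /ideal_genP fJ|].
  rewrite -dvd_ratE; apply: fJ => _ [->|->]; rewrite dvd_ratE ?dvdp_gcdl //.
  by rewrite -deriv_map dvdp_gcdr.
apply: quot_division => // f /dvdpP[q fq].
(* By Bezout a multiple of [g] is a rational combination of p and p'; clearing denominators puts an
   integer multiple of it in [J]. *)
have [[u v] /= /eqpP[[a b] /= /andP[a0 b0]]] := Bezoutp (pZtoQ p) (pZtoQ p)^`().
rewrite -/g => uvE.
have gE : g = (b^-1 *: (a *: u)) * pZtoQ p + (b^-1 *: (a *: v)) * (pZtoQ p)^`().
  by rewrite -!scalerAl -!scalerDr uvE scalerA mulVf // scale1r.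
have [k k0 [c uc]] := rat_poly_int (q * (b^-1 *: (a *: u))).
have [l l0 [d vd]] := rat_poly_int (q * (b^-1 *: (a *: v))).
exists (k * l); first by rewrite mulf_neq0.
suff -> : f *~ (k * l) = (c *~ l) * p + (d *~ k) * p^`().
  by rewrite rpredD // mul_absorbing // ideal_genS //; [left | right].
apply: pZtoQ_inj; rewrite rmorphMz rmorphD !rmorphM !rmorphMz /= fq gE -uc -vd.
rewrite deriv_map mulrDr mulrzDl !mulrA -!mulrzA [l * k]mulrC.
by rewrite -!mulrzAl.
Qed.

End Principal.

(** * The cohomology group of degree 0 *)

Section TriangleKernel.
Variable A : comPzRingType.

Definition triangle_kernel : {pred tensor_power A 'I_3} :=
  fun t => [forall r, edge_merge r t == 0].

Lemma triangle_kernelP t :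
  reflect (forall r, edge_merge r t = 0) (t \in triangle_kernel).
Proof. by apply: (iffP forallP) => tK r; apply/eqP/tK. Qed.

Fact triangle_kernel_closed : zmod_closed triangle_kernel.
Proof.
split=> [|s t /triangle_kernelP sK /triangle_kernelP tK].
  by apply/triangle_kernelP => r; rewrite raddf0.
by apply/triangle_kernelP => r; rewrite raddfB /= sK tK subrr.
Qed.
HB.instance Definition _ := GRing.isZmodClosed.Build (tensor_power A 'I_3)
  triangle_kernel triangle_kernel_closed.

Definition triangle_H0 := {t : tensor_power A 'I_3 | t \in triangle_kernel}.
HB.instance Definition _ := SubChoice.on triangle_H0.
HB.instance Definition _ := [SubChoice_isSubZmodule of triangle_H0 by <:].

Lemma triangle_H0_iso : zmod_iso (cohomology A P3 0) triangle_H0.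
Proof.
have vK (z : cocycles A P3 0) : vertex_part (val z) \in triangle_kernel.
  by have := valP z; rewrite cocycle0E => /andP[].
pose f z : triangle_H0 := Sub (vertex_part (val z)) (vK z).
have fB : zmod_morphism f.
  by move=> x y; apply: val_inj; exact: vertex_partB.
pose f' : {additive _ -> _} := HB.pack f (GRing.isZmodMorphism.Build _ _ f fB).
apply: (@quot_iso _ _ _ f') => [t|z].
  have tE := vertex_part_cochain0 (val t).
  have tc : cochain0 (val t) \in cocycle 0.
    rewrite cocycle0E tE; apply/andP; split; last exact: (valP t).
    by apply/in_degreeP => s s0; exact: cochain0_degree.
  by exists (exist _ (cochain0 (val t)) tc); apply: val_inj.
rewrite coboundary0P; apply/eqP/eqP => [zf|->]; last by rewrite raddf0.
have /andP[z0 _] := valP z.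
have /andP[o0 _] := valP (0 : cocycles A P3 0).
apply/val_inj/(eq_in_degree0 z0 o0).
have -> : vertex_part (val z) = val (f z) by [].
by rewrite -[f z]/(f' z) zf; exact: (congr1 val (esym (raddf0 f'))).
Qed.

End TriangleKernel.

(** * Dimension of the common kernel of the edge maps *)

Section TriangleDimension.
Variables (D : {pred int}) (D0 : 0 \notin D) (D1 : 1 \in D).
Hypothesis DM : {in D &, forall k l, k * l \in D}.
Variable p : {poly int}.
Hypothesis p0 : p != 0.
Local Notation m := (size p).-1.
Local Notation A := (poly_algebra p).
Local Notation nz := [pred k : int | k != 0].
Variables (phi : {additive A -> 'rV[rat]_m}) (b : 'I_m -> A).
Hypothesis phi_basis : rat_basis D phi b.

(** All maps extend to Q, and rank-nullity is applied to [F0], to [F1] on [ker F0], and to [F2] on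
    the remaining kernel. Keeping the multiplier in [D] retains integrality when [D = pred1 1]. *)
Lemma triangle_kernel_span :
  exists (phi3 : {additive tensor_power A 'I_3 -> 'rV[rat]_(m ^ #|'I_3|)}) b3
    (X : {vspace 'rV[rat]_(m ^ #|'I_3|)}),
  [/\ rat_basis D phi3 b3,
      forall t, t \in @triangle_kernel A -> phi3 t \in X,
      forall t, phi3 t \in X ->
        exists2 k, k \in D & t *~ k \in @triangle_kernel A
    & \dim X = (m * (m - 1) * (m - 2) + gcd_deriv_degree p)%N].
Proof.
have [phi3 [b3 B3]] := rat_basis_tensor D1 DM 'I_3 phi_basis.
have [phi2 [b2 B2]] := rat_basis_tensor D1 DM bool phi_basis.
have [phi1 [b1 B1]] := rat_basis_tensor D1 DM unit phi_basis.
have [phiJ [bJ BJ]] := rat_basis_deriv_quot p0.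
set g := gcd_deriv_degree p in phiJ bJ BJ *.
have nz0 : 0 \notin nz by rewrite !inE.
have [IJ dIJ Jmin] := poly_deriv_ideal p.
have [kd kdE] := kaehler_lift IJ dIJ.
have [delta deltaE] := deriv_lift dIJ.
have sumE := sum_kaehler_edges kdE deltaE.
pose e0 : 'I_3 := ord0; pose e1 : 'I_3 := ordS e0.
pose e2 : 'I_3 := opposite e0.
have lift n (U U' : zmodType) (f : {additive U -> 'rV[rat]_n}) c n'
    (f' : {additive U' -> 'rV[rat]_n'}) (h : {additive U -> U'}) :
    rat_basis D f c -> exists H : 'Hom('rV[rat]_n, 'rV[rat]_n'),
    forall u, H (f u) = f' (h u).
  move=> fc; exact: (rat_basis_lift D0 fc (f' \o h)).
have [F0 F0E] := lift _ _ _ _ _ _ phi2 (edge_merge e0) B3.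
have [F1 F1E] := lift _ _ _ _ _ _ phi2 (edge_merge e1) B3.
have [F2 F2E] := lift _ _ _ _ _ _ phi2 (edge_merge e2) B3.
have [S0 S0E] := lift _ _ _ _ _ _ phi3 (edge_section e0) B2.
have [S1 S1E] := lift _ _ _ _ _ _ phi3 (edge_section e1) B2.
have [MU MUE] := lift _ _ _ _ _ _ phi1 (@mult A) B2.
have [IN INE] := lift _ _ _ _ _ _ phi2 (@insert1 A) B1.
have [DD DDE] := lift _ _ _ _ _ _ phiJ kd B2.
have [DE DEE] := lift _ _ _ _ _ _ phiJ delta B1.
have ext3 := rat_basis_ext B3; have ext2 := rat_basis_ext B2.
(* This identity and the next ones pass from the integral maps to the rational ones by
   [rat_basis_ext]. *)
have S0K v : F0 (S0 v) = v.
  apply: (ext2 _ (F0 \o S0) idfun) => u /=.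
  by rewrite S0E F0E /= edge_sectionK.
have S1K v : F1 (S1 v) = v.
  apply: (ext2 _ (F1 \o S1) idfun) => u /=.
  by rewrite S1E F1E /= edge_sectionK.
have S1IN v : F0 (S1 v) = IN (MU v).
  apply: (ext2 _ (F0 \o S1) (IN \o MU)) => u /=.
  rewrite S1E F0E MUE INE /= -(edge_merge_opposite_section e1).
  by congr (phi2 (edge_merge _ _)); apply: val_inj.
have INK v : MU (IN v) = v.
  apply: (rat_basis_ext B1 (F := MU \o IN) (G := idfun)) => u /=.
  by rewrite INE MUE /= mult_insert1.
have MF1 v : MU (F1 v) = MU (F0 v).
  apply: (ext3 _ (MU \o F1) (MU \o F0)) => u /=.
  by rewrite F1E F0E !MUE /= !mult_edge_merge.
have MF2 v : MU (F2 v) = MU (F0 v).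
  apply: (ext3 _ (MU \o F2) (MU \o F0)) => u /=.
  by rewrite F2E F0E !MUE /= !mult_edge_merge.
have DF v : DD (F0 v) + DD (F1 v) + DD (F2 v) = DE (MU (F0 v)).
  apply: (ext3 _ ((DD \o F0) \+ (DD \o F1) \+ (DD \o F2))
                 (DE \o (MU \o F0))) => u /=.
  rewrite F0E F1E F2E MUE !DDE DEE /= mult_edge_merge -sumE.
  by rewrite sum_edges !raddfD.
pose K0 := lker F0; pose K1 := (K0 :&: lker F1)%VS.
pose X := (K1 :&: lker F2)%VS.
pose J0 := lker MU; pose W := (J0 :&: lker DD)%VS.
have imF0 : (F0 @: fullv)%VS = fullv.
  apply/eqP; rewrite eqEsubv subvf; apply/subvP => v _.
  by rewrite -[v]S0K memv_img ?memvf.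
have imF1 : (F1 @: K0)%VS = J0.
  apply/eqP; rewrite eqEsubv; apply/andP; split; apply/subvP => v.
    move/memv_imgP=> [w]; rewrite memv_ker => /eqP w0 ->.
    by rewrite memv_ker MF1 w0 linear0.
  rewrite memv_ker => /eqP v0; rewrite -[v]S1K memv_img // memv_ker.
  by rewrite S1IN v0 linear0.
have imF2 : (F2 @: K1)%VS = W.
  apply/eqP; rewrite eqEsubv; apply/andP; split; apply/subvP => v.
    move/memv_imgP=> [w]; rewrite memv_cap !memv_ker.
    case/andP => /eqP w0 /eqP w1 ->.
    have := DF w; rewrite memv_cap !memv_ker MF2 w0 w1 !linear0 eqxx !add0r.
    by move=> ->; rewrite eqxx.
  rewrite memv_cap !memv_ker => /andP[/eqP mv /eqP dv].
  (* The lifting result concerns integral tensors: [k] clears denominators of [v], while [l] and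
     [l'] turn vanishing over Q of the product and of the differential into actual vanishing. *)
  have [k k0 [u uv]] := rat_basis_span B2 v.
  have [|l lD ul] := rat_basis_ker_comp B1 (h := @mult A) (w := u).
    by rewrite -MUE uv raddfMz /= mv mul0rz.
  have [|l' l'0 ul'] := rat_basis_ker_comp BJ (h := kd) (w := u *~ l).
    by rewrite -DDE (raddfMz phi2) uv !raddfMz /= dv !mul0rz.
  have mul0 : mult (u *~ l *~ l') = 0 by rewrite raddfMz /= ul mul0rz.
  have [t [t0 t1 t2]] := kaehler_third_edge_image kdE Jmin mul0 ul'.
  have kll : k * (l * l') != 0.
    by rewrite !mulf_neq0 // (multiplier_neq0 D0).
  have vE : v *~ (k * (l * l')) = phi2 (u *~ l *~ l').
    by rewrite mulrzA mulrzA -uv !raddfMz.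
  suff : v *~ (k * (l * l')) \in (F2 @: K1)%VS.
    by rewrite -scaler_int rpredZeq intr_eq0 (negPf kll).
  rewrite vE -t2 -F2E memv_img // memv_cap !memv_ker F0E F1E.
  by rewrite /= t0 t1 raddf0 eqxx.
have imDD : (DD @: J0)%VS = fullv.
  apply/eqP; rewrite eqEsubv subvf; apply/subvP => w _.
  have [k k0 [y yw]] := rat_basis_span BJ w; have [f yf] := classP y.
  suff : w *~ k \in (DD @: J0)%VS.
    by rewrite -scaler_int rpredZeq intr_eq0 (negPf k0).
  pose u : tensor_power A bool := kdiff (rq_class _ f) (rq_class _ 'X).
  have mu : mult u = 0 by exact: mult_kdiff.
  have du : kd u = y by rewrite yf; exact: kaehler_kdiffX.
  by rewrite -yw -du -DDE memv_img // memv_ker MUE /= mu raddf0.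
have imMU : (MU @: fullv)%VS = fullv.
  apply/eqP; rewrite eqEsubv subvf; apply/subvP => v _.
  by rewrite -[v]INK memv_img ?memvf.
exists phi3, b3, X; split=> // [t /triangle_kernelP tK|t|].
- by rewrite !memv_cap !memv_ker F0E F1E F2E /= !tK raddf0 eqxx.
- rewrite !memv_cap !memv_ker F0E F1E F2E.
  case/andP => /andP[/eqP t0 /eqP t1] /eqP t2.
  have /choice[k kP] r : exists k, k \in D /\ edge_merge r (t *~ k) = 0.
    have [|k kD rtk] := rat_basis_ker_comp B2 (h := edge_merge r) (w := t).
      2: by exists k.
    by have [->|->|->] := triangle_cases e0 r.
  exists (\prod_r k r).
    by elim/big_ind: _ => [//|x y|r _]; [exact: DM | case: (kP r)].
  apply/triangle_kernelP => r; rewrite (bigD1 r) //= mulrzA raddfMz /=.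
  by have [_ ->] := kP r; rewrite mul0rz.
have dF0 := limg_ker_dim F0 fullv; have dF1 := limg_ker_dim F1 K0.
have dF2 := limg_ker_dim F2 K1; have dDD := limg_ker_dim DD J0.
have dMU := limg_ker_dim MU fullv.
rewrite imF0 capfv !dimvf !dim_matrix !mul1r in dF0.
rewrite imMU capfv !dimvf !dim_matrix !mul1r in dMU.
rewrite imDD dimvf dim_matrix mul1r -/W in dDD.
rewrite imF1 -/K1 in dF1; rewrite imF2 -/X in dF2.
rewrite -/K0 in dF0; rewrite -/J0 in dMU.
move: dF0 dF1 dF2 dDD dMU; rewrite -/m -/g.
move: (\dim X) (\dim K1) (\dim K0) (\dim J0) (\dim W) => x k1 k0 j0 w.
rewrite card_ord card_bool card_unit.
(* For m = 0 and m = 1 the truncated subtractions are harmless, since the product has a zero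
   factor. *)
case: m => [|[|n]] /=; rewrite ?expnS ?expn0; nia.
Qed.

End TriangleDimension.

(** * Multiplicities of roots *)

(** If q = r (X - z)^(k+1) with r(z) nonzero, then q' = h (X - z)^k with h(z) = (k+1) r(z), nonzero
    in characteristic zero. *)
Lemma mup_gcdp_deriv (F : numFieldType) (q : {poly F}) z : q != 0 -> root q z ->
  mup z (gcdp q q^`()) = (mup z q).-1.
Proof.
move=> q0; have [[|k] [r]] := multiplicity_XsubC q z; rewrite q0 /= => rz qE.
  by rewrite qE mulr1 (negPf rz).
move=> _; pose h := r^`() * ('X - z%:P) + r *+ k.+1.
have dq : q^`() = h * ('X - z%:P) ^+ k.
  rewrite qE derivM deriv_exp derivXsubC mul1r /= /h mulrDl exprS mulrA.
  by rewrite mulrnAr mulrnAl.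
have hz : ~~ root h z.
  rewrite /root /h hornerD hornerM hornerXsubC subrr mulr0 add0r hornerMn.
  by rewrite mulrn_eq0.
have X0 n : ('X - z%:P) ^+ n != 0 by rewrite expf_neq0 // polyXsubC_eq0.
have -> : mup z q = k.+1 by rewrite qE mupMr // mup_XsubCX eqxx.
have g0 : gcdp q q^`() != 0 by rewrite gcdp_eq0 negb_and q0.
apply/eqP; rewrite eqn_leq mup_leq // mup_geq //= !dvdp_gcd negb_and.
apply/andP; split; last by rewrite dq qE exprS !dvdp_mull.
by rewrite orbC dq exprS dvdp_mul2r // dvdp_XsubCl hz.
Qed.

Lemma sum_count_mem (T : eqType) (r s : seq T) :
  uniq r -> {subset s <= r} -> (\sum_(x <- r) count_mem x s)%N = size s.
Proof.
move=> ur; elim: s => [|y s IHs] sr; first by rewrite big1.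
rewrite /= big_split /= IHs => [|x xs]; last by rewrite sr // inE xs orbT.
have yr : y \in r by rewrite sr // mem_head.
rewrite (bigD1_seq y) //= eqxx big1 // => x /negPf.
by rewrite eq_sym => ->.
Qed.

(** The gcd is unchanged by extending the field to [algC], where its degree counts its roots with
    multiplicity; all of them are roots of p. *)
Lemma excess_multiplicityE (p : {poly int}) : p != 0 ->
  excess_multiplicity p = gcd_deriv_degree p.
Proof.
move=> p0; rewrite /excess_multiplicity /gcd_deriv_degree.
set pC : {poly algC} := map_poly intr p; set pQ : {poly rat} := map_poly intr p.
have pCE : pC = map_poly ratr pQ.
  by rewrite -map_poly_comp; apply: eq_map_poly => x /=; rewrite ratr_int.
have pC0 : pC != 0 by rewrite pCE map_poly_eq0 pZtoQ_neq0.
rewrite -(size_map_poly (ratr : rat -> algC)) gcdp_map -deriv_map -pCE.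
set g := gcdp _ _; have g0 : g != 0 by rewrite gcdp_eq0 negb_and pC0.
have [s gs] := closed_field_poly_normal g.
have [t pt] := closed_field_poly_normal pC.
have root_prod (q : {poly algC}) u : q != 0 ->
    q = lead_coef q *: \prod_(z <- u) ('X - z%:P) ->
    (root q =1 mem u) * (forall z, mup z q = count_mem z u).
  move=> q0 qu; have lq0 : lead_coef q != 0 by rewrite lead_coef_eq0.
  split=> z; rewrite qu; first by rewrite rootZ // root_prod_XsubC.
  by rewrite -mul_polyC mupMr ?mu_prod_XsubC // rootC.
have [rg mg] := root_prod g s g0 gs; have [rp _] := root_prod pC t pC0 pt.
have -> : (size g).-1 = size s.
  by rewrite gs size_scale ?lead_coef_eq0 // size_prod_XsubC.
have rgp z : root g z -> root pC z.
  by rewrite root_gcd => /andP[].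
have -> : [set z | root pC z] = [set` undup t].
  by apply/seteqP; split=> z /=; rewrite mem_undup -[z \in t]rp.
rewrite -fsbig_seq ?undup_uniq //.
rewrite -(sum_count_mem (undup_uniq t)) => [|z zs]; last first.
  by rewrite mem_undup -[_ \in _]rp rgp // rg.
apply: eq_big_seq => z.
by rewrite mem_undup -[z \in t]rp => zp; rewrite -mg mup_gcdp_deriv.
Qed.

(** * Rank and freeness of the cohomology groups *)

Lemma zmod_iso_trans (U V W : zmodType) :
  zmod_iso U V -> zmod_iso V W -> zmod_iso U W.
Proof.
move=> [f f_bij] [g g_bij]; exists (g \o f).
exact: bij_comp g_bij f_bij.
Qed.

Lemma has_rank_basis (M N : zmodType) (D : {pred int}) n
    (phi : {additive N -> 'rV[rat]_n}) b :
  0 \notin D -> zmod_iso M N -> rat_basis D phi b -> has_rank M n.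
Proof.
move=> D0 MN phib; have -> : n = \dim {:'rV[rat]_n}.
  by rewrite dimvf dim_matrix mul1r.
apply: (has_rank_span (phi := phi) MN) => [x|x|v _]; first exact: memvf.
  move=> /(rat_basis_ker phib)[k kD xk]; exists k => //.
  exact: multiplier_neq0 kD.
exact: (rat_basis_span phib).
Qed.

Lemma triangle_H0_rank (p : {poly int}) (m := (size p).-1) : p != 0 ->
  has_rank (cohomology (poly_algebra p) P3 0)
    (m * (m - 1) * (m - 2) + gcd_deriv_degree p)%N.
Proof.
move=> p0; set D : {pred int} := [pred k | k != 0].
have D0 : 0 \notin D by rewrite !inE.
have DM : {in D &, forall k l, k * l \in D} by move=> k l; exact: mulf_neq0.
have [phi [b phib]] := rat_basis_poly_algebra p0.
have [|phi3 [b3 [X [B3 KX XK <-]]]] := triangle_kernel_span D0 _ DM p0 phib.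
  by [].
apply: (has_rank_span (phi := phi3 \o val) (triangle_H0_iso _)) => [t|t|v vX].
- exact/KX/(valP t).
- move=> /(rat_basis_ker B3)[k k0 tk]; exists k => //.
  by apply: val_inj; rewrite raddfMz.
have [k k0 [t tv]] := rat_basis_span B3 v.
have [|l lD tl] := XK t; first by rewrite tv -scaler_int memvZ.
exists (k * l); first by rewrite mulf_neq0.
by exists (exist _ (t *~ l) tl); rewrite /= raddfMz tv mulrzA.
Qed.

(** A unit leading coefficient allows [D = pred1 1]: the coordinate map on the tensor cube is then
    injective with integer values, and elements with coordinates in [X] lie in the kernel itself. *)
Lemma triangle_H0_free (p : {poly int}) (m := (size p).-1) :
    lead_coef p \is a GRing.unit ->
  zmod_iso (cohomology (poly_algebra p) P3 0)
    'rV[int]_(m * (m - 1) * (m - 2) + gcd_deriv_degree p).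
Proof.
move=> pu.
have p0 : p != 0 by apply: contraTneq pu => ->; rewrite lead_coef0 unitr0.
have D0 : 0 \notin (pred1 1 : {pred int}) by rewrite !inE.
have DM : {in (pred1 1 : {pred int}) &,
    forall k l, k * l \in (pred1 1 : {pred int})}.
  by move=> k l /eqP-> /eqP->.
have [phi [b phib]] := rat_basis_poly_algebra_unit p0 pu.
have [|phi3 [b3 [X [B3 KX XK <-]]]] := triangle_kernel_span D0 _ DM p0 phib.
  exact: eqxx.
apply: zmod_iso_trans (triangle_H0_iso _) _.
apply: (lattice_iso (phi := phi3 \o val)) => [|t|t|c cX].
- apply: inj_comp val_inj; apply: additive_inj => t.
  by move=> /(rat_basis_ker B3)[k /eqP->]; rewrite mulr1z.
- exact/KX/(valP t).
- have [k /eqP-> [c tc]] := B3.2 (val t); exists (\row_i c i).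
  by rewrite -(rat_basis_sum B3) -tc mulr1z.
have cE : phi3 (\sum_i b3 i *~ c 0 i) = map_mx intr c.
  by rewrite (rat_basis_sum B3); congr map_mx; apply/rowP => i; rewrite mxE.
have [|k /eqP->] := XK (\sum_i b3 i *~ c 0 i); first by rewrite cE.
by rewrite mulr1z => tK; exists (exist _ (\sum_i b3 i *~ c 0 i) tK).
Qed.

Theorem theorem39 :
  [/\ forall p : {poly int},
        zmod_iso (cohomology (poly_algebra p) P3 1)
                 (ring_quot (ideal_gen [set p; p^`()])) /\
        (p != 0 ->
           has_rank (cohomology (poly_algebra p) P3 1) (gcd_deriv_degree p) /\
           has_rank (cohomology (poly_algebra p) P3 1) (excess_multiplicity p)),
      forall (p : {poly int}) (m := (size p).-1)
             (N := (m * (m - 1) * (m - 2) + gcd_deriv_degree p)%N),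
        (lead_coef p \is a GRing.unit ->
           zmod_iso (cohomology (poly_algebra p) P3 0) 'rV[int]_N) /\
        (p != 0 -> has_rank (cohomology (poly_algebra p) P3 0) N)
    & forall I : ideal {poly int},
        {subset I <= deriv_ideal I} /\
        zmod_iso (cohomology (ring_quot I) P3 1) (ring_quot (deriv_ideal I))].
Proof.
split=> [p|p m N|I].
- split=> [|p0]; first exact: triangle_H1_poly.
  rewrite excess_multiplicityE //.
  have [phi [b phib]] := rat_basis_deriv_quot p0.
  have rankH1 := has_rank_basis (D := [pred k | k != 0]) _
    (triangle_H1_poly p) phib.
  by split; apply: rankH1.
- by split; [exact: triangle_H0_free | exact: triangle_H0_rank].
- by split; [exact: sub_deriv_ideal | exact: triangle_H1_deriv_ideal].
Qed.
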